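(* Let $R$ be an out-connected routing matrix on the finite directed multigraph $\mathcal G=(\mathcal V,\mathcal E,\sigma,\tau)$, let $\lambda:\mathbb R_+\to\mathbb R_+^{\mathcal E}$ be a bounded measurable function of time, let $\mathcal X=\mathbb R_+^{\mathcal E}$, and let $\zeta:\mathcal X\to\mathcal X$ be Lipschitz continuous. Then for every initial condition $x^0\in\mathcal X$ the dynamics $$\dot x=\lambda-(I-R^T)z,\qquad x\ge 0,\qquad 0\le z\le \zeta(x),\qquad x^T(\zeta(x)-z)=0$$ with $x(0)=x^0$ admits a unique solution $(x,z)$ on $[0,+\infty)$.
   Context: $\mathbb R_+$ denotes the non-negative reals. For a finite set $\mathcal A$, $\mathbb R^{\mathcal A}$ is the space of real vectors indexed by $\mathcal A$. Inequalities between vectors are entrywise. A directed multigraph is a 4-tuple $\mathcal G=(\mathcal V,\mathcal E,\sigma,\tau)$ with $\mathcal V$ a finite set of nodes, $\mathcal E$ a finite set of links (also called cells), and maps $\sigma,\tau:\mathcal E\to\mathcal V$ (tail and head) such that $\sigma(i)\neq\tau(i)$ for all $i\in\mathcal E$. A routing matrix is a matrix $R\in\mathbb R_+^{\mathcal E\times\mathcal E}$ such that $R_{ij}=0$ whenever $\tau(i)\neq\sigma(j)$, and $\sum_{j\in\mathcal E}R_{ij}\le 1$ for every $i\in\mathcal E$. It is out-connected if for every $i\in\mathcal E$ there exist $j\in\mathcal E$ and an integer $k\ge 0$ such that $\sum_{e\in\mathcal E}R_{je}<1$ and $(R^k)_{ij}>0$. A solution on an interval $J$ ($J=[0,T]$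 or $J=[0,+\infty)$) with initial condition $x^0$ is a pair $(x,z)$ with $x:J\to\mathbb R^{\mathcal E}$ locally absolutely continuous, $x(0)=x^0$, $z:J\to\mathbb R^{\mathcal E}$ measurable, $x(t)\ge 0$ for all $t\in J$, and, for almost every $t\in J$, $\dot x(t)=\lambda(t)-(I-R^T)z(t)$, $0\le z(t)\le\zeta(x(t))$ and $x(t)^T(\zeta(x(t))-z(t))=0$. Two solutions are identified if their $x$-components coincide and their $z$-components coincide almost everywhere. *)

(* Defs.v *)
From HB Require Import structures.
From mathcomp Require Import all_boot all_order all_algebra.
From mathcomp Require Import all_classical all_reals all_analysis.
From mathcomp Require Import measurable_realfun.

Set Implicit Arguments.
Unset Strict Implicit.
Unset Printing Implicit Defensive.

Import Order.TTheory GRing.Theory Num.Theory.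
Import numFieldNormedType.Exports.

Local Open Scope classical_set_scope.
Local Open Scope ring_scope.

Record multigraph : Type := Multigraph {
  node : finType;
  link : finType;
  tail : link -> node;
  head : link -> node;
  tail_neq_head : forall e : link, tail e != head e }.

(* R^E is the space of column vectors 'cV[R]_#|link G|: the coordinate
   i : 'I_#|link G| stands for the link enum_val i. *)

Definition routing_matrix (R : realType) (G : multigraph)
    (P : 'M[R]_#|link G|) : Prop :=
  [/\ forall i j, 0 <= P i j,
      forall i j : 'I_#|link G|,
        head (enum_val i) <> tail (enum_val j) -> P i j = 0 &
      forall i, \sum_j P i j <= 1].

Definition out_connected (R : realType) (n : nat) (P : 'M[R]_n) : Prop :=
  forall i : 'I_n, exists (j : 'I_n) (k : nat),
    \sum_e P j e < 1 /\ 0 < (P ^+ k) i j.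

Definition vecle (R : realType) (n : nat) (u v : 'cV[R]_n) : Prop :=
  forall i, u i 0 <= v i 0.

Definition orthant (R : realType) (n : nat) : set 'cV[R]_n :=
  [set v | vecle 0 v].
Arguments orthant : clear implicits.

(* Lebesgue (not only Borel) measurability of a vector-valued function of
   time: the domain carries the completion of the Borel sigma-algebra with
   respect to the Lebesgue measure. *)
Definition lebesgue_measurable (R : realType) (n : nat) (D : set R)
    (f : R -> 'cV[R]_n) : Prop :=
  forall i : 'I_n,
    measurable_fun
      (D : set (g_sigma_algebraType
                  (completed_algebra_gen (@lebesgue_measure R))))
      ((fun t => f t i 0) : _ -> measurableTypeR R).

Definition absolutely_continuous (R : realType) (V : normedModType R)
    (a b : R) (f : R -> V) : Prop :=
  forall eps : R, 0 < eps -> exists2 delta : R, 0 < delta &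
    forall (m : nat) (B : 'I_m -> R * R),
      (forall k, (B k).1 <= (B k).2 /\ `[(B k).1, (B k).2] `<=` `[a, b]) ->
      trivIset setT (fun k => `](B k).1, (B k).2[%classic) ->
      \sum_k ((B k).2 - (B k).1) < delta ->
      \sum_k `|f (B k).2 - f (B k).1| < eps.

Definition locally_absolutely_continuous (R : realType) (V : normedModType R)
    (J : interval R) (f : R -> V) : Prop :=
  forall a b : R, a <= b -> `[a, b] `<=` [set` J] ->
    absolutely_continuous a b f.

(* Only the restrictions of x and z to J matter: the derivative of x is
   unaffected by values outside J except possibly at the endpoints of J,
   which form a null set. *)
Definition is_solution (R : realType) (n : nat) (P : 'M[R]_n)
    (lambda : R -> 'cV[R]_n) (zeta : 'cV[R]_n -> 'cV[R]_n)
    (J : interval R) (x0 : 'cV[R]_n) (x z : R -> 'cV[R]_n) : Prop :=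
  [/\ locally_absolutely_continuous J x /\ x 0 = x0,
      lebesgue_measurable [set` J] z,
      forall t, t \in J -> vecle 0 (x t) &
      {ae @lebesgue_measure R, forall t, t \in J ->
        [/\ is_derive t 1 x (lambda t - (1%:M - P^T) *m z t),
            vecle 0 (z t),
            vecle (z t) (zeta (x t)) &
            (x t)^T *m (zeta (x t) - z t) = 0]}].

Definition same_solution (R : realType) (n : nat) (J : interval R)
    (x z x' z' : R -> 'cV[R]_n) : Prop :=
  (forall t, t \in J -> x t = x' t) /\
  {ae @lebesgue_measure R, forall t, t \in J -> z t = z' t}.

(* Main.v *)
(* Uniqueness. Write y = zeta x - z for the slack and let (x, z), (x', z') be two
   solutions. Where x_i differs from x'_i, complementarity makes y dissipate
   |x_i - x'_i|; where both vanish their derivatives vanish too, since x_i has a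
   minimum there. Summing over i and using that P is substochastic, the slack
   terms cancel and sum_i |x_i - x'_i| has almost everywhere an upper derivative
   at most 2 n Lip(zeta) times itself, hence is zero. Then z = z' almost
   everywhere because out-connectedness makes I - P^T injective.

   Existence. The explicit scheme with outflow min (zeta_i x, x_i / h) keeps x
   nonnegative, and its total mass grows at most linearly, so states and
   cumulated outflows are Lipschitz in time uniformly in h. A pointwise limit as
   h tends to 0 along an ultrafilter gives a nondecreasing locally Lipschitz Z
   with x = x0 + int lambda - (I - P^T) Z. At each point where Z_i is derivable,
   Z_i' lies between 0 and zeta_i x, and equals zeta_i x when x_i > 0. Finally Z
   is derivable almost everywhere, by the Radon-Nikodym theorem for the
   Lebesgue-Stieltjes measure of Z and Lebesgue differentiation. *)

Require Import Defs.
From HB Require Import structures.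
From mathcomp Require Import all_boot all_order all_algebra.
From mathcomp Require Import all_classical all_reals all_analysis.
From mathcomp Require Import measurable_realfun.
From mathcomp Require Import ring lra.

Set Implicit Arguments.
Unset Strict Implicit.
Unset Printing Implicit Defensive.

Import Order.TTheory GRing.Theory Num.Theory.
Import numFieldNormedType.Exports.

Local Open Scope classical_set_scope.
Local Open Scope ring_scope.

(** * Absolutely continuous functions and upper derivatives *)

(** The open interiors are disjoint subsets of [U] with the same lengths, so additivity and
    monotonicity of the measure apply. *)
Lemma sorted_intervals_length_le (R : realType) (U : set R) (m : nat)
    (B : nat -> R * R) :
  open U ->
  (forall k, (k < m)%N -> (B k).1 <= (B k).2 /\ `[(B k).1, (B k).2] `<=` U) ->
  (forall j k, (j < k < m)%N -> (B j).2 <= (B k).1) ->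
  ((\sum_(k < m) ((B k).2 - (B k).1))%:E <= lebesgue_measure U)%E.
Proof.
move=> oU BU Bsort.
pose I k : set R := if (k < m)%N then `](B k).1, (B k).2[%classic else set0.
have mI k : measurable (I k).
  by rewrite /I; case: ifP => _; [exact: measurable_itv|exact: measurable0].
have tI : trivIset setT I.
  apply: ltn_trivIset => j k kj; rewrite /I; case: ifP => km; last by rewrite set0I.
  case: ifP => jm; last by rewrite setI0.
  rewrite -subset0 => t /= []; rewrite !in_itv/= => /andP[_ t1] /andP[t2 _].
  have /le_lt_trans : (B k).2 <= (B j).1 by apply: Bsort; rewrite kj.
  by move=> /(_ _ t2) /lt_trans/(_ t1); rewrite ltxx.
rewrite [X in (X <= _)%E](_ : _ =
    lebesgue_measure (\big[setU/set0]_(k < m) I k)); last first.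
  rewrite measure_bigsetU// -sumEFin; apply: eq_bigr => k _.
  rewrite /I ltn_ord; apply: esym; apply: etrans (lebesgue_measure_itv _) _.
  rewrite /= lte_fin.
  case: ltP => // B21; rewrite (_ : (B k).2 = (B k).1) ?subrr//.
  by apply/le_anti; rewrite B21 (BU _ (ltn_ord k)).1.
apply: le_measure; rewrite ?inE.
- apply: bigsetU_measurable => k _; exact: mI.
- exact: open_measurable.
- rewrite -bigcup_mkord; apply: bigcup_sub => k /= km t.
  rewrite /I km => It; apply: (BU _ km).2.
  exact: subset_itv_oo_cc.
Qed.

(** Time 0 is discarded wherever an argument needs a two-sided neighbourhood inside the
    half-line. *)
Lemma ae_neq0 (R : realType) : {ae @lebesgue_measure R, forall t, t != 0}.
Proof.
exists [set 0]; split => //; first exact: lebesgue_measure_set1.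
by move=> t /= /negP/negPn/eqP.
Qed.

Lemma negligible_open_cover (R : realType) (N : set R) (e : R) :
  (@lebesgue_measure R).-negligible N -> 0 < e ->
  exists U : set R, [/\ open U, N `<=` U & (lebesgue_measure U < e%:E)%E].
Proof.
move=> [A [mA A0 NA]] e0.
have [|U [oU AU muU]] := @lebesgue_regularity_outer R A e mA _ e0.
  apply: (@le_lt_trans _ _ 0%E); rewrite ?ltry// le_eqVlt.
  by apply/orP; left; apply/eqP.
exists U; split => //; first exact: subset_trans AU.
have mU : measurable U by exact: open_measurable.
rewrite -(setDUK AU) measureU//=.
- by rewrite [X in (X + _)%E](A0 : _ = 0%E) add0e.
- exact: measurableD.
- by rewrite setDIK.
Qed.

Section upper_derivative.
Variables (R : realType) (a b K : R) (f : R -> R) (N : set R).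
Hypothesis ab : a <= b.
Hypothesis fac : absolutely_continuous a b f.
Hypothesis Nnull : (@lebesgue_measure R).-negligible N.
(** The upper derivative is expressed through intervals straddling [t], so that [f] itself need not
    be derivable. *)
Hypothesis fN : forall t : R, a <= t <= b -> ~ N t -> forall e : R, 0 < e ->
  exists2 d : R, 0 < d & forall u v : R, a <= u <= t -> t <= v <= b -> v - u < d ->
    f v - f u <= (K + e) * (v - u).

(* The bound holds up to t, except for the increments over finitely many
   consecutive intervals contained in a small open cover U of the null set. *)
Let S (e : R) (U : set R) (t : R) := exists (m : nat) (B : nat -> R * R),
  [/\ forall k, (k < m)%N -> [/\ a <= (B k).1, (B k).1 <= (B k).2, (B k).2 <= t
        & `[(B k).1, (B k).2] `<=` U],
      forall j k, (j < k < m)%N -> (B j).2 <= (B k).1 &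
      f t - f a <= (K + e) * (t - a) + \sum_(k < m) `|f (B k).2 - f (B k).1|].

Let S_gauge e U u v : u <= v -> S e U u ->
  f v - f u <= (K + e) * (v - u) -> S e U v.
Proof.
move=> uv [m [B [BU Bs fB]]] fuv; exists m, B; split => //.
  by move=> k /BU[? ? Bu ?]; split => //; exact: le_trans uv.
by move: fB fuv; set X := \sum_(_ < _) _; nra.
Qed.

Let S_append e U u v : 0 <= K + e -> a <= u -> u <= v -> `[u, v] `<=` U ->
  S e U u -> S e U v.
Proof.
move=> Ke au uv uvU [m [B [BU Bs fB]]].
exists m.+1, (fun k => if k == m then (u, v) else B k); split.
- move=> k; rewrite ltnS leq_eqVlt; case: eqP => [->|_ /= km]; first by split.
  by have [? ? Bu ?] := BU _ km; split => //; exact: le_trans uv.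
- move=> j k /andP[jk]; rewrite ltnS leq_eqVlt.
  case: eqP => [km _|km /= ltkm].
    subst k; rewrite (ltn_eqF jk) /=.
    by have [] := BU _ jk.
  rewrite (ltn_eqF (ltn_trans jk ltkm)).
  by apply: Bs; rewrite jk.
rewrite big_ord_recr /= eqxx/=.
under eq_bigr do rewrite (ltn_eqF (ltn_ord _)).
move: fB; set X := \sum_(_ < _) _ => fB.
have := ler_norm (f v - f u).
by nra.
Qed.

(** Consider the supremum of the times reached by [S]. Outside [N] the upper derivative carries the
    bound past it; inside [N] an interval contained in [U] is appended. The increments over the
    appended intervals are small by absolute continuity, since their total length is at most the
    measure of [U]. *)
Lemma absolutely_continuous_le_of_upper_derivative : 0 <= K ->
  f b - f a <= K * (b - a).
Proof.
move=> K0; have ab' := ab; apply/ler_addgt0Pr => e' e'0.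
(* The slope error [e * (b - a)] and the increments over [U], which stay below [e], add up to at
   most [e']. *)
pose e := e' / (1 + (b - a)).
have ba0 : 0 < 1 + (b - a) by lra.
have e0 : 0 < e by rewrite divr_gt0.
have [d d0 fd] := fac e0.
have [U [oU NU Ud]] := negligible_open_cover Nnull d0.
suff : S e U b.
  move=> [m [B [BU Bs fB]]].
  have : \sum_(k < m) `|f (B k).2 - f (B k).1| < e.
    apply: (fd m (fun k => B k)).
    - move=> k; have [? ? ? ?] := BU _ (ltn_ord k); split => // t /=.
      by rewrite !in_itv/= => /andP[? ?]; apply/andP; split; lra.
    - apply/trivIsetP => i j _ _ ij; rewrite -subset0 => t /=.
      rewrite !in_itv/= => -[/andP[i1 i2] /andP[j1 j2]].
      have : (i != j :> nat) by [].
      rewrite neq_ltn => /orP[] lij.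
        have /(lt_le_trans i2)/lt_trans/(_ j1) : (B i).2 <= (B j).1.
          by apply: Bs; rewrite lij ltn_ord.
        by rewrite ltxx.
      have /(lt_le_trans j2)/lt_trans/(_ i1) : (B j).2 <= (B i).1.
        by apply: Bs; rewrite lij ltn_ord.
      by rewrite ltxx.
    rewrite -lte_fin; apply: le_lt_trans Ud.
    apply: sorted_intervals_length_le => // k km.
    by have [] := BU _ km.
  move: fB; set X := \sum_(_ < _) _ => fB Xe.
  have eE : e * (1 + (b - a)) = e' by rewrite /e divfK// gt_eqF.
  by nra.
pose A : set R := [set t | a <= t <= b /\ S e U t].
have Aa : A a.
  split; first by rewrite lexx.
  by exists 0%N, (fun=> (0, 0)); split => //; rewrite big_ord0 !subrr mulr0 addr0.
have hA : has_sup A.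
  by split; [exists a|exists b => t [/andP[]]].
pose s := sup A.
have as_ : a <= s by apply: ub_le_sup => //; exact: hA.2.
have sb : s <= b by apply: ge_sup => //; [exists a|move=> t [/andP[]]].
have [r r0 step] : exists2 r, 0 < r & forall u v, a <= u <= s -> s <= v <= b ->
    v - u < r -> S e U u -> S e U v.
  have [Ns|Ns] := pselect (N s).
    have [r /= r0 rU] := (nbhs_ballP _ _).1 (open_nbhs_nbhs (conj oU (NU _ Ns))).
    exists r => // u v /andP[au us] /andP[sv vb] uvr; apply: S_append => //.
    - by lra.
    - by lra.
    - move=> t /=; rewrite in_itv/= => /andP[ut tv]; apply: rU.
      by rewrite /ball/= ltr_norml; apply/andP; split; lra.
  have [|r r0 fr] := @fN s _ Ns e e0; first by rewrite as_.
  exists r => // u v uas sv uvr Su; apply: (S_gauge _ Su); last exact: fr.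
  by case/andP: uas; case/andP: sv; lra.
have [t At st] : exists2 t, A t & s - r / 2 < t.
  by apply: sup_adherent => //; rewrite divr_gt0.
have ts : t <= s by apply: ub_le_sup => //; exact: hA.2.
have [/andP[at_ tb] St] := At.
(* [S] is known at some [t] within [r / 2] of [s], not at [s] itself. The step from [t] to [v] is
   still shorter than [r], and [v] exceeds the supremum unless it is [b]. *)
pose v := Num.min b (s + r / 4).
have sv : s <= v by rewrite le_min sb/=; lra.
have vb : v <= b by rewrite ge_min lexx.
have vr : v <= s + r / 4 by rewrite ge_min lexx orbT.
have Sv : S e U v.
  apply: step St; [by rewrite at_|by rewrite sv|by lra].
have : v <= s.
  apply: ub_le_sup; first exact: hA.2.
  by split => //; rewrite vb andbT; lra.
move=> vs; suff <- : v = b by [].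
rewrite /v; case: (leP b (s + r / 4)) => // h.
by exfalso; move: vs; rewrite /v minEle (lt_geF h); lra.
Qed.

End upper_derivative.

(** * Entrywise bounds for matrix norms *)

Section entrywise.
Variables (R : realType) (m n : nat).
Implicit Types M : 'M[R]_(m, n).

Lemma normr_coord_le M i j : `|M i j| <= `|M|.
Proof.
rewrite [leRHS]/Num.norm/= mx_normrE.
exact: (@le_bigmax _ _ _ _ (fun ij : 'I_m * 'I_n => `|M ij.1 ij.2|) (i, j)).
Qed.

Lemma normr_le_coord M (e : R) : 0 <= e -> (forall i j, `|M i j| <= e) -> `|M| <= e.
Proof.
move=> e0 Me; rewrite [leLHS]/Num.norm/= mx_normrE.
by apply: bigmax_le => // -[i j] _ /=; exact: Me.
Qed.

End entrywise.

Lemma normr_le_sum_coord (R : realType) n (x : 'cV[R]_n) :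
  `|x| <= \sum_i `|x i 0|.
Proof.
apply: normr_le_coord => [|i j]; first exact: sumr_ge0.
by rewrite ord1 (bigD1 i)//= lerDl sumr_ge0.
Qed.

Lemma sum_ord_le (R : realType) n (a : 'I_n -> R) (c : R) :
  (forall i, a i <= c) -> \sum_i a i <= n%:R * c.
Proof.
move=> ac; apply: le_trans (ler_sum _ (fun i _ => ac i)) _.
by rewrite sumr_const card_ord mulr_natl.
Qed.

(** * Derivatives of real functions at a point *)

Section real_derivative.
Variable R : realType.
Implicit Types (f : R -> R) (t v g e : R).

Lemma is_derive_linear_approx f t v : is_derive t 1 f v <->
  forall e : R, 0 < e -> exists2 d : R, 0 < d & forall s : R, `|s - t| < d ->
    `|f s - f t - (s - t) * v| <= e * `|s - t|.
Proof.
split => [[df fv] e e0|fP].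
  have /cvgrPdist_le :
      h^-1 *: ((f \o shift t) (h *: (1:R)) - f t) @[h --> 0^'] --> v.
    by rewrite -fv; exact: df.
  move=> /(_ _ e0) [d /= d0 fd]; exists d => // s std.
  have [->|st] := eqVneq s t; first by rewrite !subrr mul0r subr0 normr0 mulr0.
  have := fd (s - t); rewrite /ball/= sub0r normrN => /(_ std).
  rewrite subr_eq0 => /(_ st); rewrite scaler1 subrK => h.
  have st0 : s - t != 0 by rewrite subr_eq0.
  rewrite (_ : f s - f t - (s - t) * v =
      - ((v - (s - t)^-1 *: (f s - f t)) * (s - t))).
    by rewrite normrN normrM ler_wpM2r.
  by rewrite /GRing.scale/=; field.
have cv : h^-1 *: ((f \o shift t) (h *: (1:R)) - f t) @[h --> 0^'] --> v.
  apply/cvgrPdist_le => e e0; have [d d0 fd] := fP e e0.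
  exists d => //= h; rewrite /ball/= sub0r normrN => hd h0.
  have := fd (h + t); rewrite addrK => /(_ hd).
  rewrite -ler_pdivrMr ?normr_gt0// -normfV -normrM; apply: le_trans.
  rewrite le_eqVlt; apply/orP; left; apply/eqP.
  rewrite scaler1 -[LHS]normrN; congr (`|_|).
  by rewrite /GRing.scale/=; field.
by split; [apply/cvg_ex; exists v|exact: cvg_lim].
Qed.

Lemma is_derive_straddle f t v : is_derive t 1 f v ->
  forall e : R, 0 < e -> exists2 d : R, 0 < d &
    forall r s : R, r <= t <= s -> s - r < d ->
    `|f s - f r - (s - r) * v| <= e * (s - r).
Proof.
move=> /is_derive_linear_approx fP e e0; have [d d0 fd] := fP e e0.
exists d => // r s /andP[rt ts] srd.
have := fd r; rewrite distrC ger0_norm ?subr_ge0// => /(_ ltac:(lra)).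
have := fd s; rewrite ger0_norm ?subr_ge0// => /(_ ltac:(lra)).
rewrite !ler_norml => /andP[? ?] /andP[? ?]; apply/andP; split; nra.
Qed.

(** The absolute value need not be derivable at a zero of [f], so only increments are bounded from
    above. Where [f t] is nonzero the sign of [f] is constant nearby; at a zero the increment of the
    absolute value is at most the absolute value of the increment. *)
Lemma normr_upper_derivative f t v g : is_derive t 1 f v ->
  (0 < f t -> v <= g) -> (f t < 0 -> - v <= g) -> (f t = 0 -> `|v| <= g) ->
  forall e : R, 0 < e -> exists2 d : R, 0 < d &
    forall r s : R, r <= t <= s -> s - r < d ->
    `|f s| - `|f r| <= (g + e) * (s - r).
Proof.
move=> fv pos neg zero e e0.
have [d d0 fd] := is_derive_straddle fv e0.
have [d' d'0 fd'] : exists2 d', 0 < d' & forall s, `|s - t| < d' ->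
    f t != 0 -> `|f s - f t| < `|f t|.
  have [ft0|ft0] := eqVneq (f t) 0; first by exists 1 => // s _; rewrite ?ft0 ?eqxx.
  have [d1 d10 fd1] := (is_derive_linear_approx f t v).1 fv 1 ltr01.
  (* With approximation error 1, [f] moves by at most [|s - t| * (1 + |v|)], which on this radius is
     less than [|f t|], so the sign is kept. *)
  exists (Num.min d1 (`|f t| / (1 + `|v|))).
    by rewrite lt_min d10 divr_gt0 ?normr_gt0// ltr_pwDl.
  move=> s; rewrite lt_min => /andP[sd1 sd2] _.
  rewrite -(subrK ((s - t) * v) (f s - f t)) (le_lt_trans (ler_normD _ _))//.
  rewrite normrM; apply: (@le_lt_trans _ _ (`|s - t| * (1 + `|v|))).
    by rewrite mulrDr mulr1 lerD2r -[leRHS]mul1r fd1.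
  by rewrite -ltr_pdivlMr// ltr_pwDl.
exists (Num.min d d') => [|r s rts]; first by rewrite lt_min d0.
rewrite lt_min => /andP[srd srd']; have /andP[rt ts] := rts.
have := fd _ _ rts srd; rewrite ler_norml => /andP[fd1 fd2].
have r' : `|r - t| < d' by rewrite distrC ger0_norm ?subr_ge0//; lra.
have s' : `|s - t| < d' by rewrite ger0_norm ?subr_ge0//; lra.
case: (ltrgtP (f t) 0) => ft.
- have := fd' _ r'; have := fd' _ s'.
  rewrite (lt_eqF ft) => /(_ erefl) + /(_ erefl).
  rewrite (ltr0_norm ft) !ltr_norml => /andP[? ?] /andP[? ?].
  have := neg ft; rewrite !ltr0_norm; [|lra..]; nra.
- have := fd' _ r'; have := fd' _ s'.
  rewrite (gt_eqF ft) => /(_ erefl) + /(_ erefl).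
  rewrite (gtr0_norm ft) !ltr_norml => /andP[? ?] /andP[? ?].
  have := pos ft; rewrite !gtr0_norm; [|lra..]; nra.
- apply: le_trans (lerB_dist _ _) _ => //.
  have := zero ft; rewrite !ler_norml => /andP[? ?].
  by apply/andP; split; nra.
Qed.

(** Fermat's rule. Since [f] is nonnegative only on the half-line, [0 < t] is what permits
    comparison with [t - h] as well as [t + h]. *)
Lemma is_derive_at_zero_min f t v : is_derive t 1 f v -> 0 < t -> f t = 0 ->
  (forall s : R, 0 <= s -> 0 <= f s) -> v = 0.
Proof.
move=> /is_derive_linear_approx fP t0 ft f0; apply/eqP.
rewrite -normr_eq0 eq_le normr_ge0 andbT leNgt; apply/negP => v0.
have [d d0 fd] := fP (`|v| / 2) ltac:(by rewrite divr_gt0).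
pose h := Num.min (d / 2) t.
have h0 : 0 < h by rewrite lt_min t0 divr_gt0.
have hd : h < d by rewrite gt_min; apply/orP; left; lra.
have ht : h <= t by rewrite ge_min lexx orbT.
have := fd (t + h); have := fd (t - h).
rewrite !(addrC t) !addrK normrN (gtr0_norm h0) => /(_ hd) + /(_ hd).
have := f0 (h + t) ltac:(lra); have := f0 (- h + t) ltac:(lra).
rewrite ft !ler_norml; clearbody h; have : 0 < h * `|v| by rewrite mulr_gt0.
by case: (ger0P v) v0 => ? ? ? ? ? /andP[? ?] /andP[? ?]; nra.
Qed.

End real_derivative.

Lemma is_derive_coord (R : realType) n (x : R -> 'cV[R]_n) (t : R)
    (v : 'cV[R]_n) i :
  is_derive t 1 x v -> is_derive t 1 (fun s => x s i 0) (v i 0).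
Proof.
move=> [dx xv]; have dx' := (derivable_mxP _ _ _).1 dx.
by split; [exact: dx'|rewrite -xv derive_mx// mxE].
Qed.

(** * Uniqueness *)

Lemma lipschitz_orthantP (R : realType) n (zeta : 'cV[R]_n -> 'cV[R]_n) :
  [lipschitz zeta x | x in orthant R n] -> exists2 L : R, 0 <= L &
    forall x y, orthant R n x -> orthant R n y ->
      `|zeta x - zeta y| <= L * `|x - y|.
Proof.
move=> zL; have : \forall L \near +oo, (0 <= L) /\ L.-lipschitz_(orthant R n) zeta.
  apply: filterS2 (nbhs_pinfty_ge (@real0 R)) zL => L L0 zL; split => //.
move=> /filter_ex[L [L0 zLip]]; exists L => // x y x0 y0.
by apply: (zLip (x, y)); split.
Qed.

Section flow.
Variables (R : realType) (n : nat) (P : 'M[R]_n).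
Hypothesis P_ge0 : forall i j, 0 <= P i j.
Hypothesis P_le1 : forall i, \sum_j P i j <= 1.

Lemma flow_coord (z : 'cV[R]_n) i :
  ((1%:M - P^T) *m z) i 0 = z i 0 - \sum_j P j i * z j 0.
Proof.
rewrite mulmxBl mul1mx !mxE; congr (_ - _).
by apply: eq_bigr => j _; rewrite !mxE.
Qed.

(** After exchanging the sums, row [j] weighs [a j] by at most 1: routing creates no mass. *)
Lemma sum_routed_le (a : 'I_n -> R) : (forall i, 0 <= a i) ->
  \sum_i \sum_j P j i * a j <= \sum_j a j.
Proof.
move=> a0; rewrite exchange_big/=; apply: ler_sum => j _.
by rewrite -mulr_suml -[leRHS]mul1r ler_wpM2r.
Qed.

Lemma ge0_complementarity (x q : 'cV[R]_n) : vecle 0 x -> vecle 0 q ->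
  x^T *m q = 0 -> forall i, 0 < x i 0 -> q i 0 = 0.
Proof.
move=> x0 q0 xq i xi.
have /psumr_eq0P xq0 : forall j : 'I_n, true -> 0 <= x j 0 * q j 0.
  by move=> j _; rewrite mulr_ge0//; [have := x0 j|have := q0 j]; rewrite mxE.
have : \sum_j x j 0 * q j 0 = 0.
  have /matrixP/(_ 0 0) := xq; rewrite [in RHS]mxE [in LHS]mxE => xq0'.
  apply: etrans xq0'.
  by apply: eq_bigr => j _; rewrite mxE.
by move=> /xq0/(_ i isT)/eqP; rewrite mulf_eq0 (gt_eqF xi)/= => /eqP.
Qed.

(* Where x_i and x'_i differ the slack y = zeta x - z dissipates the distance;
   where they agree at 0 both derivatives vanish, and the resulting balance
   equation gives the same bound. *)
Lemma distance_derivative_bound (l x x' z z' q q' : 'cV[R]_n) i :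
  let v := (l - (1%:M - P^T) *m z) - (l - (1%:M - P^T) *m z') in
  let dy j := `|(q j 0 - z j 0) - (q' j 0 - z' j 0)| in
  let dq j := `|q j 0 - q' j 0| in
  let g := - dy i + \sum_j P j i * dy j + (dq i + \sum_j P j i * dq j) in
  vecle 0 x -> vecle 0 x' -> vecle z q -> vecle z' q' ->
  (0 < x i 0 -> q i 0 - z i 0 = 0) -> (0 < x' i 0 -> q' i 0 - z' i 0 = 0) ->
  (x i 0 = 0 -> x' i 0 = 0 -> v i 0 = 0) ->
  [/\ 0 < x i 0 - x' i 0 -> v i 0 <= g, x i 0 - x' i 0 < 0 -> - v i 0 <= g
    & x i 0 - x' i 0 = 0 -> `|v i 0| <= g].
Proof.
move=> v dy dq g x0 x'0 zq zq' cx cx' v0.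
have x0i : 0 <= x i 0 by have := x0 i; rewrite mxE.
have x'0i : 0 <= x' i 0 by have := x'0 i; rewrite mxE.
pose y j := (q j 0 - z j 0) - (q' j 0 - z' j 0).
(* Writing each outflow as capacity minus slack splits the velocity difference into a slack part and
   a part governed by the Lipschitz bound on [zeta]. *)
have vE : v i 0 = y i - (q i 0 - q' i 0) -
    (\sum_j P j i * y j - \sum_j P j i * (q j 0 - q' j 0)).
  have lE w : (l - (1%:M - P^T) *m w) i 0 = l i 0 - (w i 0 - \sum_j P j i * w j 0).
    by rewrite mxE [X in _ + X]mxE flow_coord.
  rewrite -sumrB [X in _ - X](_ : _ = \sum_j P j i * z' j 0 - \sum_j P j i * z j 0).
    by rewrite /v mxE [X in _ + X]mxE !lE /y; ring.
  by rewrite -sumrB; apply: eq_bigr => j _; rewrite /y; ring.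
have sumB (a : 'I_n -> R) : `|\sum_j P j i * a j| <= \sum_j P j i * `|a j|.
  apply: le_trans (ler_norm_sum _ _ _) _; apply: ler_sum => j _.
  by rewrite normrM ger0_norm.
have := sumB y; have := sumB (fun j => q j 0 - q' j 0).
have := normr_ge0 (v i 0); rewrite -/(dq i).
have := ler_norm (q i 0 - q' i 0); have := ler_norm (- (q i 0 - q' i 0)).
rewrite normrN {}/g -/(dq i) !(ler_norml (\sum_j _)).
set A := \sum_j P j i * y j; set B := \sum_j P j i * (q j 0 - q' j 0).
rewrite -/A -/B in vE.
set A' := \sum_j P j i * dy j; set B' := \sum_j P j i * dq j.
move=> d1 d2 nv0 /andP[B1 B2] /andP[A1 A2].
split=> h.
(* The first state is strictly larger, hence positive: its slack vanishes, and the slack of the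
   second one pulls the two together. *)
- have yi : y i = - dy i.
    rewrite /dy -/(y i) /y cx; last lra.
    by rewrite sub0r normrN ger0_norm// subr_ge0.
  by rewrite vE yi; lra.
- have yi : y i = dy i.
    rewrite /dy -/(y i) /y cx'; last lra.
    by rewrite subr0 ger0_norm// subr_ge0.
  by rewrite vE yi; lra.
- case: (ltrgtP (x i 0) 0) => [|xi|xi]; first by lra.
    have yi : y i = 0 by rewrite /y cx// cx' ?subr0//; lra.
    have -> : dy i = 0 by rewrite /dy -/(y i) yi normr0.
    by rewrite vE yi ler_norml; apply/andP; split; lra.
  (* Both cells are empty and the velocities agree, so [vE] becomes an equation for [y i]; solving
     it shows that the bound is nonnegative. *)
  have x'i : x' i 0 = 0 by lra.
  move: (v0 xi x'i) => vi; rewrite vi normr0; move: vE; rewrite vi => yE.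
  have : dy i <= A' + (dq i + B').
    by rewrite /dy -/(y i) ler_norml; apply/andP; split; lra.
  by lra.
Qed.

(** By [sum_routed_le] the routed slack is absorbed by the negative slack terms, and the routed [dq]
    costs one more copy of the sum, hence the factor 2. *)
Lemma sum_distance_derivative_bound (dy dq : 'I_n -> R) :
  (forall i, 0 <= dy i) -> (forall i, 0 <= dq i) ->
  \sum_i (- dy i + \sum_j P j i * dy j + (dq i + \sum_j P j i * dq j)) <=
  2 * \sum_i dq i.
Proof.
move=> dy0 dq0; rewrite !big_split/= sumrN.
by have := sum_routed_le dy0; have := sum_routed_le dq0; lra.
Qed.

End flow.

(** * A Gronwall inequality for absolutely continuous functions *)

Lemma absolutely_continuous_sub (R : realType) (V : normedModType R)
    (a b c d : R) (f : R -> V) : a <= c -> d <= b ->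
  absolutely_continuous a b f -> absolutely_continuous c d f.
Proof.
move=> ac db fac e e0; have [r r0 fr] := fac e e0; exists r => // m B Bcd.
apply: fr => k; have [B12 BI] := Bcd k; split => // t /BI /=.
by rewrite !in_itv/= => /andP[? ?]; apply/andP; split; lra.
Qed.

Lemma absolutely_continuous_uniform (R : realType) (V : normedModType R)
    (a b : R) (f : R -> V) : absolutely_continuous a b f ->
  forall e : R, 0 < e -> exists2 d : R, 0 < d & forall u v : R,
    a <= u -> u <= v -> v <= b -> v - u < d -> `|f v - f u| < e.
Proof.
move=> fac e e0; have [d d0 fd] := fac e e0; exists d => // u v au uv vb uvd.
have := fd 1%N (fun=> (u, v)); rewrite !big_ord1/=; apply => //.
  move=> _; split=> // t /=; rewrite !in_itv/= => /andP[ut tv].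
  by rewrite (le_trans au ut) (le_trans tv vb).
by apply/trivIsetP => i j; rewrite !ord1.
Qed.

(* On a short interval starting at a zero of f, absolute continuity bounds f,
   and integrating the differential inequality halves every upper bound. *)
Lemma absolutely_continuous_gronwall (R : realType) (T C : R) (f : R -> R)
    (N : set R) : 0 <= C -> absolutely_continuous 0 T f ->
  (@lebesgue_measure R).-negligible N -> (forall t : R, 0 <= f t) -> f 0 = 0 ->
  (forall t : R, 0 <= t <= T -> ~ N t -> forall e : R, 0 < e ->
    exists2 d : R, 0 < d &
      forall u v : R, 0 <= u <= t -> t <= v <= T -> v - u < d ->
      f v - f u <= (C * f t + e) * (v - u)) ->
  forall t : R, 0 <= t <= T -> f t = 0.
Proof.
move=> C0 fac Nnull f_ge0 f0 fN.
have [r r0 fr] := absolutely_continuous_uniform fac ltr01.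
(* The first bound keeps [f] at most 1 over one step, so that its supremum exists; the second gives
   [C * h <= 1/2]. *)
pose h := Num.min (r / 2) (2 * (C + 1))^-1.
have h0 : 0 < h by rewrite lt_min divr_gt0//= invr_gt0; lra.
have hr : h < r by rewrite gt_min; apply/orP; left; lra.
have hC : C * h <= 2^-1.
  have : h <= (2 * (C + 1))^-1 by rewrite ge_min lexx orbT.
  rewrite -(ler_pM2l (_ : 0 < 2 * (C + 1)))?divff; [|lra..].
  by nra.
have step (a : R) : 0 <= a -> f a = 0 ->
    forall t : R, a <= t <= a + h -> t <= T -> f t = 0.
  move=> a0 fa0.
  pose A := [set f t | t in [set t | a <= t <= a + h /\ t <= T]].
  move=> t0 t0ah t0T.
  have A0 : A !=set0 by exists (f t0), t0.
  have Aub : ubound A 1.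
    move=> _ [t [/andP[at_ tah] tT] <-].
    apply: ltW; have := fr a t a0 at_ tT.
    by rewrite fa0 subr0 ger0_norm//; apply; lra.
  have sA : has_sup A by split => //; exists 1.
  pose M := sup A.
  have leM (t : R) : a <= t <= a + h -> t <= T -> f t <= M.
    by move=> tah tT; apply: ub_le_sup; [exact: sA.2|exists t].
  have M0 : 0 <= M by apply: le_trans (leM _ t0ah t0T).
  (* The growth rate is at most [C * M] on the step, whose length makes the total growth at most
     [M / 2]. *)
  suff : M <= M / 2.
    move=> MM; apply/le_anti; rewrite f_ge0 andbT.
    by have := leM _ t0ah t0T; lra.
  apply: ge_sup => // _ [t [/andP[at_ tah] tT] <-].
  have : f t - f a <= (C * M) * (t - a).
    apply: (@absolutely_continuous_le_of_upper_derivative R a t (C * M) f N) => //.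
    - by apply: absolutely_continuous_sub fac => //; lra.
    - move=> s /andP[as_ st] Ns e e0.
      have sT : 0 <= s <= T by apply/andP; split; lra.
      have [d d0 fd] := fN s sT Ns e e0.
      exists d => // u v /andP[? ?] /andP[? ?] uvd.
      have := fd u v ltac:(by apply/andP; split; lra)
        ltac:(by apply/andP; split; lra) uvd.
      move=> /le_trans; apply; rewrite ler_wpM2r ?subr_ge0 ?lerD2r//; first lra.
      by rewrite ler_wpM2l// leM//; lra.
    - by rewrite mulr_ge0.
  have : (C * M) * (t - a) <= (C * M) * h by rewrite ler_wpM2l ?mulr_ge0//; lra.
  by rewrite fa0; nra.
have all k (t : R) : 0 <= t <= k%:R * h -> t <= T -> f t = 0.
  elim: k t => [|k IH] t.
    by rewrite mul0r => /le_anti <-.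
  rewrite -natr1 mulrDl mul1r => /andP[t0 tk] tT.
  have [tkh|tkh] := leP t (k%:R * h); first by apply: IH; rewrite ?t0.
  have k0 : 0 <= k%:R * h by rewrite mulr_ge0// ltW.
  apply: (step (k%:R * h)) => //; last by rewrite ltW.
  by apply: IH; rewrite ?k0 ?lexx//; lra.
move=> t /andP[t0 tT]; apply: (all (Num.bound (t / h))) => //.
by rewrite t0 -ler_pdivrMr// ltW// archi_boundP// divr_ge0// ltW.
Qed.

Lemma bigmin_gt0 (R : realType) n (d : 'I_n -> R) : (forall i, 0 < d i) ->
  exists2 r, 0 < r & forall i, r <= d i.
Proof.
move=> d0; exists (\big[Num.min/1]_i d i) => [|i].
  by apply: lt_bigmin => // i _.
exact: bigmin_le_cond.
Qed.

Section solution_uniqueness.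
Variables (R : realType) (n : nat) (P : 'M[R]_n).
Hypothesis P_ge0 : forall i j, 0 <= P i j.
Hypothesis P_le1 : forall i, \sum_j P i j <= 1.
Variables (lambda : R -> 'cV[R]_n) (zeta : 'cV[R]_n -> 'cV[R]_n) (x0 : 'cV[R]_n).
Hypothesis zeta_lipschitz : [lipschitz zeta x | x in orthant R n].

Lemma solution_path_unique x x' z z' :
  is_solution P lambda zeta `[0, +oo[ x0 x z ->
  is_solution P lambda zeta `[0, +oo[ x0 x' z' ->
  forall t, t \in `[0, +oo[ -> x t = x' t.
Proof.
move=> [[xac xx0] _ x_ge0 xz] [[x'ac x'x0] _ x'_ge0 xz'].
have [L L0 zL] := lipschitz_orthantP zeta_lipschitz.
have {}x_ge0 (t : R) : 0 <= t -> vecle 0 (x t).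
  by move=> t0; apply: x_ge0; rewrite in_itv/= t0.
have {}x'_ge0 (t : R) : 0 <= t -> vecle 0 (x' t).
  by move=> t0; apply: x'_ge0; rewrite in_itv/= t0.
(* The sum of absolute values, rather than the sup norm, is the distance for which substochastic
   rows let the slack terms cancel. *)
pose f t := \sum_i `|x t i 0 - x' t i 0|.
suff fT (T t : R) : 0 <= t <= T -> f t = 0.
  move=> t; rewrite in_itv/= andbT => t0.
  have /psumr_eq0P ft : f t = 0 by apply: (fT t); rewrite t0 lexx.
  apply/matrixP => i j; rewrite ord1; apply/eqP; rewrite -subr_eq0 -normr_eq0.
  by apply/eqP/ft.
have [T0|T0] := leP 0 T; last by move=> /andP[]; lra.
move: t.
have FF : Filter (almost_everywhere (@lebesgue_measure R)).
  exact: ae_filter_ringOfSetsType.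
have Nnull : (@lebesgue_measure R).-negligible (~` _) :=
  @filterI _ _ FF _ _ xz (@filterI _ _ FF _ _ xz' (ae_neq0 R)).
(* The 2 comes from [sum_distance_derivative_bound], and [n * L] from summing the sup-norm Lipschitz
   bound over the coordinates. *)
pose C := 2 * n%:R * L.
apply: (@absolutely_continuous_gronwall R T C f _ _ _ Nnull).
- by rewrite /C !mulr_ge0.
- have tI : [set` `[0, T]] `<=` [set` `[0, +oo[].
    by move=> t /=; rewrite !in_itv/= => /andP[->].
  (* Each of the [n] coordinates inherits one such error from each of the two paths; [n + 1] avoids
     a zero denominator. *)
  move=> e e0; have e1 : 0 < e / 2 / (n%:R + 1) by rewrite !divr_gt0// ltr_wpDl.
  have [d d0 xd] := xac 0 T T0 tI _ e1.
  have [d' d'0 x'd] := x'ac 0 T T0 tI _ e1.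
  exists (Num.min d d') => [|m B BT Btriv]; first by rewrite lt_min d0.
  rewrite lt_min => /andP[/(xd m B BT Btriv) xB /(x'd m B BT Btriv) x'B].
  apply: (@le_lt_trans _ _ (n%:R * (\sum_k `|x (B k).2 - x (B k).1| +
      \sum_k `|x' (B k).2 - x' (B k).1|))).
    rewrite -big_split/= mulr_sumr; apply: ler_sum => k _.
    apply: le_trans (_ : \sum_i (`|x (B k).2 i 0 - x (B k).1 i 0| +
      `|x' (B k).2 i 0 - x' (B k).1 i 0|) <= _).
      rewrite /f -sumrB; apply: le_trans (ler_norm_sum _ _ _) _.
      apply: ler_sum => i _; apply: le_trans (ler_dist_dist _ _) _.
      rewrite (_ : _ - _ = (x (B k).2 i 0 - x (B k).1 i 0) -
        (x' (B k).2 i 0 - x' (B k).1 i 0)); last by ring.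
      exact: ler_normB.
    apply: sum_ord_le => i; apply: lerD.
      by have := normr_coord_le (x (B k).2 - x (B k).1) i 0; rewrite !mxE.
    by have := normr_coord_le (x' (B k).2 - x' (B k).1) i 0; rewrite !mxE.
  have n1 : 0 < n%:R + 1 :> R by rewrite ltr_wpDl.
  have : e / 2 / (n%:R + 1) * (n%:R + 1) = e / 2 by rewrite divfK// gt_eqF.
  have := ler0n R n; move: xB x'B e1 n1.
  set A := \sum_k _; set A' := \sum_k _; set r := e / 2 / _; set m' := n%:R.
  by move=> *; nra.
- by move=> t; apply: sumr_ge0.
- by rewrite /f big1// => i _; rewrite xx0 x'x0 subrr normr0.
move=> t /andP[t0 tT] /contrapT[xt [x't tneq0]] e e0.
have tgt0 : 0 < t by rewrite lt_neqAle eq_sym tneq0.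
have tin : t \in `[0, +oo[ by rewrite in_itv/= t0.
have [dx z0 zx cx] := xt tin.
have [dx' z'0 zx' cx'] := x't tin.
pose v := (lambda t - (1%:M - P^T) *m z t) - (lambda t - (1%:M - P^T) *m z' t).
pose dy i := `|(zeta (x t) i 0 - z t i 0) - (zeta (x' t) i 0 - z' t i 0)|.
pose dq i := `|zeta (x t) i 0 - zeta (x' t) i 0|.
pose g i := - dy i + \sum_j P j i * dy j + (dq i + \sum_j P j i * dq j).
have sumg : \sum_i g i <= C * f t.
  apply: le_trans (sum_distance_derivative_bound P_le1 (dy := dy) (dq := dq)
    (fun=> normr_ge0 _) (fun=> normr_ge0 _)) _.
  rewrite /C -!mulrA ler_pM2l//.
  apply: sum_ord_le => i.
  have := normr_coord_le (zeta (x t) - zeta (x' t)) i 0.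
  rewrite mxE [in X in `|_ + X|]mxE => /le_trans; apply.
  apply: le_trans (zL _ _ _ _) _; [exact: x_ge0|exact: x'_ge0|].
  rewrite ler_wpM2l//; apply: le_trans (normr_le_sum_coord _) _.
  by apply: ler_sum => j _; rewrite !mxE.
have di i : is_derive t 1 (fun s => x s i 0 - x' s i 0) (v i 0).
  rewrite /v mxE [X in _ + X]mxE.
  exact: is_deriveB (is_derive_coord i dx) (is_derive_coord i dx').
have gi i : exists2 d : R, 0 < d & forall r s : R, r <= t <= s -> s - r < d ->
      `|x s i 0 - x' s i 0| - `|x r i 0 - x' r i 0| <=
      (g i + e / (n%:R + 1)) * (s - r).
  have [|||pos neg zero] := @distance_derivative_bound R n P P_ge0 (lambda t)
     (x t) (x' t) (z t) (z' t) (zeta (x t)) (zeta (x' t)) i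
     (x_ge0 _ t0) (x'_ge0 _ t0) zx zx'.
  - move=> xi; have := ge0_complementarity (x_ge0 _ t0) _ cx xi.
    rewrite !mxE; apply.
    by move=> j; rewrite !mxE subr_ge0.
  - move=> xi; have := ge0_complementarity (x'_ge0 _ t0) _ cx' xi.
    rewrite !mxE; apply.
    by move=> j; rewrite !mxE subr_ge0.
  - move=> xi x'i; rewrite mxE [X in _ + X]mxE.
    rewrite (is_derive_at_zero_min (is_derive_coord i dx) tgt0 xi) => [|s s0].
      rewrite (is_derive_at_zero_min (is_derive_coord i dx') tgt0 x'i).
        by rewrite subr0.
      move=> s s0.
      by have := x'_ge0 _ s0 i; rewrite mxE.
    by have := x_ge0 _ s0 i; rewrite mxE.
  apply: (normr_upper_derivative (di i) pos neg zero).
  by rewrite divr_gt0// ltr_wpDl.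
have [d d0 dP] : exists2 d : R, 0 < d &
    forall i (r s : R), r <= t <= s -> s - r < d ->
      `|x s i 0 - x' s i 0| - `|x r i 0 - x' r i 0| <=
      (g i + e / (n%:R + 1)) * (s - r).
  pose d i := projT1 (cid2 (gi i)).
  have [|r r0 rd] := @bigmin_gt0 R n d.
    by move=> i; rewrite /d; case: cid2.
  exists r => // i u s uts us; have := rd i; rewrite /d; case: cid2 => /= d' _ H.
  by move=> rd'; apply: H => //; exact: lt_le_trans rd'.
exists d => // u s /andP[u0 ut] /andP[ts sT] us.
rewrite /f -sumrB; apply: le_trans (ler_sum _ (fun i _ => dP i u s _ us)) _.
  by rewrite ut.
rewrite -mulr_suml big_split/= sumr_const card_ord.
rewrite ler_wpM2r//; first lra.
apply: lerD => //.
rewrite -[_ / _ *+ _]mulr_natr mulrAC ler_pdivrMr; last by rewrite ltr_wpDl.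
by rewrite ler_wpM2l ?ltW// ltrDl.
Qed.

End solution_uniqueness.

(** The vector [a] of absolute values satisfies [a i <= \sum_j P j i * a j]. Summing,
    substochasticity forces equality everywhere and makes [a] vanish on rows with sum below 1.
    Iterating the equality [k] times expresses such a zero entry as a nonnegative combination, so
    [a i] vanishes wherever [(P ^+ k) i j] is positive. *)
Lemma out_connected_flow_inj (R : realType) n (P : 'M[R]_n) (d : 'cV[R]_n) :
  (forall i j, 0 <= P i j) -> (forall i, \sum_j P i j <= 1) ->
  out_connected P -> (1%:M - P^T) *m d = 0 -> d = 0.
Proof.
move=> P_ge0 P_le1 Pout dP0.
pose a i := `|d i 0|.
have dE i : d i 0 = \sum_j P j i * d j 0.
  by apply/eqP; rewrite -subr_eq0 -flow_coord dP0 mxE.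
have a_le i : a i <= \sum_j P j i * a j.
  rewrite /a dE; apply: le_trans (ler_norm_sum _ _ _) _; apply: ler_sum => j _.
  by rewrite normrM ger0_norm.
have sumE : \sum_i \sum_j P j i * a j = \sum_j a j * \sum_i P j i.
  rewrite exchange_big; apply: eq_bigr => j _.
  by rewrite mulr_sumr; apply: eq_bigr => i _; rewrite mulrC.
have r_le j : a j * (\sum_i P j i) <= a j.
  by rewrite -[leRHS]mulr1 ler_wpM2l ?normr_ge0.
have sum_le : \sum_i a i <= \sum_i \sum_j P j i * a j by exact: ler_sum.
(* The total loss, the sum of [a j] times the deficit of row [j], is at most 0 while all its terms
   are nonnegative. *)
have rE j : \sum_e P j e < 1 -> a j = 0.
  move=> rj; have /eqP : \sum_j (a j - a j * \sum_i P j i) = 0.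
    apply/le_anti/andP; split; first by rewrite sumrB -sumE subr_le0.
    by apply: sumr_ge0 => l _; rewrite subr_ge0 r_le.
  rewrite psumr_eq0 => [/allP/(_ j (mem_index_enum _))/=|l _]; last first.
    by rewrite subr_ge0 r_le.
  rewrite -{1}[a j]mulr1 -mulrBr mulf_eq0 subr_eq0.
  by rewrite [X in _ || X]eq_sym (lt_eqF rj) orbF => /eqP.
have aE i : a i = \sum_j P j i * a j.
  have /eqP : \sum_i (\sum_j P j i * a j - a i) = 0.
    apply/le_anti/andP; split; last by rewrite sumrB subr_ge0.
    by rewrite sumrB subr_le0 sumE ler_sum.
  rewrite psumr_eq0 => [/allP/(_ i (mem_index_enum _))/=|l _]; last first.
    by rewrite subr_ge0.
  by rewrite subr_eq0 => /eqP.
have akE k j : a j = \sum_i (P ^+ k) i j * a i.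
  elim: k j => [|k IH] j.
    rewrite expr0 (bigD1 j)//= big1 ?addr0 => [|i ij].
      by rewrite mxE eqxx mul1r.
    by rewrite mxE (negbTE ij) mul0r.
  rewrite aE exprSr; under eq_bigr do rewrite IH mulr_sumr.
  rewrite exchange_big; apply: eq_bigr => i _.
  rewrite mxE mulr_suml; apply: eq_bigr => l _.
  by rewrite mulrCA mulrA.
have Pk_ge0 k i j : 0 <= (P ^+ k) i j.
  elim: k i j => [|k IH] i j; first by rewrite expr0 mxE ler0n.
  by rewrite exprS mxE sumr_ge0// => l _; rewrite mulr_ge0.
apply/matrixP => i j; rewrite ord1 mxE; apply/eqP; rewrite -normr_eq0 -/(a i).
have [l [k [rl Pil]]] := Pout i.
have /eqP := rE _ rl; rewrite (akE k) psumr_eq0 => [|s _]; last first.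
  by rewrite mulr_ge0// normr_ge0.
by move=> /allP/(_ i (mem_index_enum _)) /=; rewrite mulf_eq0 (gt_eqF Pil).
Qed.

Lemma solution_unique (R : realType) n (P : 'M[R]_n)
    (lambda : R -> 'cV[R]_n) (zeta : 'cV[R]_n -> 'cV[R]_n) (x0 : 'cV[R]_n)
    (x z x' z' : R -> 'cV[R]_n) :
  (forall i j, 0 <= P i j) -> (forall i, \sum_j P i j <= 1) ->
  out_connected P -> [lipschitz zeta x | x in orthant R n] ->
  is_solution P lambda zeta `[0, +oo[ x0 x z ->
  is_solution P lambda zeta `[0, +oo[ x0 x' z' ->
  same_solution `[0, +oo[ x z x' z'.
Proof.
move=> P_ge0 P_le1 Pout zL xz xz'.
have xx' := solution_path_unique P_ge0 P_le1 zL xz xz'.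
split=> //.
have [_ _ _ aexz] := xz; have [_ _ _ aexz'] := xz'.
have FF : Filter (almost_everywhere (@lebesgue_measure R)).
  exact: ae_filter_ringOfSetsType.
apply: filterS3 (ae_neq0 R) aexz aexz' => t tneq0 xt x't tJ.
have [dx _ _ _] := xt tJ; have [dx' _ _ _] := x't tJ.
have t0 : 0 < t by move: tJ; rewrite in_itv/= andbT le_eqVlt eq_sym (negbTE tneq0).
apply/eqP; rewrite -subr_eq0; apply/eqP/(out_connected_flow_inj P_ge0 P_le1 Pout).
have : lambda t - (1%:M - P^T) *m z t = lambda t - (1%:M - P^T) *m z' t.
  (* The paths coincide near [t > 0], so both velocities are the derivative of [x] and the flows
     [(I - P^T) z] and [(I - P^T) z'] agree. *)
  have dx'x : is_derive t 1 x (lambda t - (1%:M - P^T) *m z' t).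
    apply: near_eq_is_derive dx'.
    near=> s; apply/esym/xx'; rewrite in_itv/= andbT ltW//.
    by near: s; exact: lt_nbhsr.
  by rewrite -(@derive_val _ _ _ _ _ _ _ dx) -(@derive_val _ _ _ _ _ _ _ dx'x).
by move/addrI/oppr_inj; rewrite mulmxBr => ->; rewrite subrr.
Unshelve. all: by end_near. Qed.

(** * Almost everywhere derivability *)

Section lebesgue_stieltjes_contraction.
Variables (R : realType) (F : R -> R).
Hypothesis F_nd : forall u v : R, u <= v -> F u <= F v.
Hypothesis F_contraction : forall u v : R, u <= v -> F v - F u <= v - u.

Let F_nondecreasing : nondecreasing F.
Proof. by move=> u v uv; exact: F_nd. Qed.

Let contraction_continuous (G : R -> R) :
  (forall u v : R, u <= v -> G u <= G v) ->
  (forall u v : R, u <= v -> G v - G u <= v - u) -> continuous G.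
Proof.
move=> Gnd GC t; apply/cvgrPdist_le => e e0; exists e => //= s.
rewrite /ball/= => tse; apply: le_trans (ltW tse).
have [st|ts] := leP s t.
  by rewrite !ger0_norm ?subr_ge0//; [exact: GC|exact: Gnd].
rewrite distrC (distrC t) !ger0_norm ?subr_ge0//; [|exact: ltW|exact/Gnd/ltW].
exact/GC/ltW.
Qed.

Let F_rc : right_continuous F.
Proof. exact/right_continuousW/contraction_continuous. Qed.

HB.instance Definition _ := isCumulative.Build R _ R F F_nondecreasing F_rc.

Let G (t : R) := t - F t.

Let G_nondecreasing : nondecreasing G.
Proof. by move=> u v uv; have := F_contraction uv; rewrite /G; lra. Qed.

Let G_rc : right_continuous G.
Proof.
apply/right_continuousW/contraction_continuous => u v uv.
  exact: G_nondecreasing.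
by have := F_nd uv; rewrite /G; lra.
Qed.

HB.instance Definition _ := isCumulative.Build R _ R G G_nondecreasing G_rc.

Lemma stieltjes_itv (H : cumulative R R) (a b : R) : a <= b ->
  lebesgue_stieltjes_measure H `]a, b]%classic = (H b - H a)%:E.
Proof.
move=> ab; rewrite -(wlength_itv_bnd H false false ab).
by apply: measurable_mu_extE; exact: is_ocitv.
Qed.

(* F and t - F t are both nondecreasing and their Stieltjes measures add up to
   the Lebesgue measure. *)
Lemma stieltjes_contraction_le A : measurable A ->
  (lebesgue_stieltjes_measure (F : cumulative R R) A <= lebesgue_measure A)%E.
Proof.
move=> mA.
pose nu := measure_add (lebesgue_stieltjes_measure (F : cumulative R R))
  (lebesgue_stieltjes_measure (G : cumulative R R)).
suff -> : lebesgue_measure A = (lebesgue_stieltjes_measure (F : cumulative R R) A +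
    lebesgue_stieltjes_measure (G : cumulative R R) A)%E by rewrite leeDl.
apply: etrans (measure_addE _ _ _).
apply: (lebesgue_measure_unique (mu := nu)) mA.
move=> X /ocitvP[->|[[a b]/= ab ->]]; first by rewrite !measure0.
apply: etrans (esym (measure_addE _ _ _)).
apply: etrans (stieltjes_itv _ (ltW ab)) _; apply: esym.
apply: etrans (congr2 adde (stieltjes_itv (F : cumulative R R) (ltW ab))
  (stieltjes_itv (G : cumulative R R) (ltW ab))) _.
have -> : b - a = F b - F a + ((b - F b) - (a - F a)) by ring.
by [].
Qed.

(** On each bounded interval the Stieltjes measure of [F] is finite and dominated by the Lebesgue
    measure. Its Radon-Nikodym density makes [F] a constant plus an indefinite integral, which
    Lebesgue differentiation handles. *)
Lemma contraction_ae_derivable :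
  {ae @lebesgue_measure R, forall t, derivable F t 1}.
Proof.
have FF : Filter (almost_everywhere (@lebesgue_measure R)).
  exact: ae_filter_ringOfSetsType.
suff k_ae k : {ae @lebesgue_measure R,
    forall t, t \in `]- k%:R, k%:R[ -> derivable F t 1}.
  have := @negligible_bigcup _ _ _ (@lebesgue_measure R) _ k_ae.
  apply: negligibleS => t /= Ft.
  exists (Num.bound `|t|) => //= H; apply: Ft; apply: H.
  have := archi_boundP (normr_ge0 t); rewrite in_itv/= => tb.
  by rewrite -ltr_norml.
pose D : set (measurableTypeR R) := [set` `]- k%:R, k%:R]].
have mD : measurable D by exact: measurable_itv.
have kk : - k%:R <= k%:R :> R by rewrite ge0_cp.
have Doo : (lebesgue_stieltjes_measure (F : cumulative R R) D < +oo)%E.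
  by rewrite (stieltjes_itv (F : cumulative R R) kk) ltry.
have nu_mu : mfrestr mD Doo `<< @lebesgue_measure R.
  apply/null_content_dominatesP => A mA A0; apply/eqP.
  rewrite -measure_le0 -[leRHS]A0.
  apply: le_trans (stieltjes_contraction_le mA).
  by rewrite /mfrestr /mrestr; apply: measureIl.
have [f [f0 ffin fint fE]] := radon_nikodym_sigma_finite nu_mu.
have ffE : f = EFin \o (fine \o f).
  by apply/funext => t /=; rewrite fineK.
rewrite ffE in fint.
have fint' y : (@lebesgue_measure R).-integrable [set` `]- k%:R, y]]
    (EFin \o (fine \o f)).
  by apply: integrableS fint => //; exact: measurable_itv.
have floc : locally_integrable [set: R] (fine \o f).
  have := integrable_locally measurableT fint.
  by rewrite patch_setT.
apply: filterS (FTC1 fint' floc) => t; rewrite in_itv/= => tP /andP[kt tk].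
have [|dt _] := tP; first by rewrite lte_fin.
have /near_eq_derivable : {near t, (fun y =>
    F (- k%:R) + \int[lebesgue_measure]_(s in `]- k%:R, y]) (fine \o f) s) =1 F}.
  near=> y.
  have ky : - k%:R < y by near: y; exact: lt_nbhsr.
  have yk : y < k%:R by near: y; exact: lt_nbhsl.
  rewrite /Rintegral.
  transitivity (F (- k%:R) + fine (mfrestr mD Doo [set` `]- k%:R, y]])).
    rewrite fE; last exact: measurable_itv.
    by congr (_ + fine _); apply: eq_integral => s _; rewrite /= fineK.
  have yD : [set` `]- k%:R, y]] `<=` D.
    by move=> s; rewrite /D/= !in_itv/= => /andP[-> /le_trans]; apply; exact: ltW.
  rewrite /mfrestr /mrestr (setIidl yD).
  by rewrite (stieltjes_itv (F : cumulative R R) (ltW ky))/= addrC subrK.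
apply.
by apply: derivableD.
Unshelve. all: by end_near. Qed.

End lebesgue_stieltjes_contraction.

(** * Primitives of bounded Lebesgue measurable functions *)

Lemma borel_lebesgue_measurable (R : realType) (A : set (measurableTypeR R)) :
  measurable A ->
  measurable (A : set (g_sigma_algebraType
    (completed_algebra_gen (@lebesgue_measure R)))).
Proof.
move=> mA; apply: sub_sigma_algebra; exists A => //.
by exists set0; [exact: negligible_set0|rewrite setU0].
Qed.

Lemma negligible_bigcup_rat (R : realType) (F : rat -> set R) :
  (forall q, (@lebesgue_measure R).-negligible (F q)) ->
  (@lebesgue_measure R).-negligible (\bigcup_q F q).
Proof.
move=> F0; pose G k := if unpickle k is Some q then F q else set0.
apply: (@negligibleS _ _ _ (@lebesgue_measure R) (\bigcup_k G k)).
  move=> t [q _ Fqt]; exists (pickle q); first exact: I.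
  rewrite /G pickleK; exact: Fqt.
apply: negligible_bigcup => k; rewrite /G.
by case: unpickle => [q|]; [exact: F0|exact: negligible_set0].
Qed.

Section bounded_primitive.
Variables (R : realType) (l : R -> R) (M : R).
Hypothesis l_meas : measurable_fun
  (`[0, +oo[%classic : set (g_sigma_algebraType
     (completed_algebra_gen (@lebesgue_measure R))))
  (l : _ -> measurableTypeR R).
Hypothesis l_bound : forall t : R, 0 <= t -> 0 <= l t <= M.

(** Each set where [l] exceeds a rational is Borel up to a null set. These countably many null sets
    lie in one Borel null set [B], and replacing [l] by 0 on [B] makes it Borel. *)
Lemma borel_representative : exists g : R -> R,
  [/\ measurable_fun setT g, forall t : R, 0 <= g t <= M &
    {ae @lebesgue_measure R, forall t : R, 0 <= t -> g t = l t}].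
Proof.
have M0 : 0 <= M by have /andP[] := l_bound (lexx 0); exact: le_trans.
pose E (q : rat) : set R := `[0, +oo[%classic `&` [set t | ratr q < l t].
have EP q : exists A N : set R,
    [/\ measurable (A : set (measurableTypeR R)),
        (@lebesgue_measure R).-negligible N & A `|` N = E q].
  have mJ : measurable (`[0, +oo[%classic : set (g_sigma_algebraType
     (completed_algebra_gen (@lebesgue_measure R)))).
    by apply: borel_lebesgue_measurable; exact: measurable_itv.
  have [A mA [N N0 ANE]] : completed_algebra_gen (@lebesgue_measure R)
      (`[0, +oo[%classic `&` l @^-1` `]ratr q, +oo[%classic).
    rewrite -g_sigma_completed_algebra_genE.
    exact: (l_meas mJ (measurable_itv `]ratr q, +oo[)).
  exists A, N; split => //; rewrite ANE /E; congr (_ `&` _).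
  by apply/seteqP; split => t /=; rewrite in_itv/= andbT.
have /choice[A /choice[N ANP]] := EP.
have [B [mB B0 NB]] : (@lebesgue_measure R).-negligible (\bigcup_q N q).
  by apply: negligible_bigcup_rat => q; have [] := ANP q.
pose g t := if (0 <= t) && (t \notin B) then l t else 0.
exists g; split.
- move=> _; apply: (measurability _ (RGenOInfty.measurableE R)) => //.
  move=> _ [_ [c ->] <-]; rewrite setTI.
  have [c0|c0] := ltP c 0.
    rewrite [X in measurable X](_ : _ = setT)//; apply/seteqP; split => // t _ /=.
    rewrite in_itv/= andbT /g; case: ifPn => // /andP[t0 _].
    by have /andP[l0 _] := l_bound t0; exact: lt_le_trans l0.
  (* A rational between [c] and [l t] witnesses [c < g t]; on [B] the value 0 does not exceed the
     nonnegative [c]. *)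
  rewrite [X in measurable X](_ : _ =
      \bigcup_(q : rat) (if c <= ratr q then A q `\` B else set0)).
    apply: bigcupT_measurable_rat => q; case: ifP => // _.
    by apply: measurableD => //; have [] := ANP q.
  apply/seteqP; split => t /=; rewrite in_itv/= andbT /g.
    case: ifPn => [/andP[t0 tB] clt|_]; last by rewrite ltNge c0.
    have [q] := rat_in_itvoo clt; rewrite in_itv/= => /andP[cq qlt].
    exists q => //; rewrite (ltW cq); split; last by rewrite notin_setE in tB.
    have : E q t by split=> //=; rewrite in_itv/= t0.
    have [_ _ <-] := ANP q => -[//|Nqt].
    by exfalso; move: tB; rewrite notin_setE; apply; apply: NB; exists q.
  move=> [q _]; case: ifP => // cq [Aqt Bt].
  have : E q t by have [_ _ <-] := ANP q; left.
  rewrite /E/= in_itv/= andbT => -[t0 qlt].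
  have tB : t \notin B by rewrite notin_setE.
  by rewrite t0 tB (le_lt_trans cq).
- move=> t; rewrite /g; case: ifP => [/andP[t0 _]|_]; first exact: l_bound.
  by rewrite lexx.
- exists B; split => // t /= H; apply: contrapT => Bt; apply: H => t0.
  have tB : t \notin B by rewrite notin_setE.
  by rewrite /g t0 tB.
Qed.

Lemma bounded_measurable_primitive : exists L : R -> R,
  [/\ L 0 = 0, forall u v : R, 0 <= u -> u <= v -> 0 <= L v - L u <= M * (v - u) &
    {ae @lebesgue_measure R, forall t : R, 0 <= t -> is_derive t 1 L (l t)}].
Proof.
have [g [mg gM gl]] := borel_representative.
have M0 : 0 <= M by have /andP[] := l_bound (lexx 0); exact: le_trans.
have g_int (A : set (measurableTypeR R)) : measurable A ->
    (lebesgue_measure A < +oo)%E ->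
    (@lebesgue_measure R).-integrable A (EFin \o g).
  move=> mA Aoo; apply: measurable_bounded_integrable => //.
  - exact: measurable_funTS.
  - exists M; split; first exact: num_real.
    move=> c Mc t _ /=; have /andP[g0 gM'] := gM t.
    by rewrite ger0_norm// (le_trans gM')// ltW.
have itv_oo (a b : bool) (u v : R) :
    (lebesgue_measure [set` Interval (BSide a u) (BSide b v)] < +oo)%E.
  by rewrite lebesgue_measure_itv/=; case: ifP => _; rewrite ltry.
have g_loc : locally_integrable setT g.
  split=> //; first exact: openT.
  move=> K _ cK; have mK := compact_measurable cK.
  by have /integrableP[] := g_int _ mK (compact_finite_measure cK).
have gi (a b : bool) (u v : R) := g_int _ (measurable_itv _) (itv_oo a b u v).
pose L t := (\int[lebesgue_measure]_(s in `[0, t]) g s)%R.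
have FF : Filter (almost_everywhere (@lebesgue_measure R)).
  exact: ae_filter_ringOfSetsType.
exists L; split.
- by rewrite /L set_itv1 Rintegral_set1.
- move=> u v u0 uv; rewrite /L Rintegral_itvB ?bnd_simp//.
  rewrite Rintegral_ge0 => [|t _]; last by have /andP[] := gM t.
  have -> : M * (v - u) = (\int[lebesgue_measure]_(s in `]u, v]) (cst M s))%R.
    rewrite Rintegral_cst; last exact: measurable_itv.
    congr (M * _); apply: (congr1 fine (_ : (v - u)%:E = _)).
    apply: esym; apply: etrans (lebesgue_measure_itv _) _.
    rewrite /= lte_fin; case: ltP => //= vu.
    by rewrite (_ : v = u) ?subrr//; apply/le_anti; rewrite vu uv.
  apply: le_Rintegral.
  - exact: measurable_itv.
  - exact: gi.
  - apply: measurable_bounded_integrable => //.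
    + exact: itv_oo.
    + exists M; split; first exact: num_real.
      by move=> c Mc t _ /=; rewrite ger0_norm// ltW.
  - by move=> t _; have /andP[] := gM t.
- apply: filterS3 (ae_neq0 R) gl (FTC1 (fun y => gi true false 0 y) g_loc).
  move=> t t0 glt Lt t_ge0; rewrite -glt//.
  have [|dL <-] := Lt; first by rewrite lte_fin lt_neqAle eq_sym t0.
  by rewrite derive1E; exact: DeriveDef.
Qed.

End bounded_primitive.

(** * The explicit scheme and its limit *)

Section euler_scheme.
Variables (R : realType) (n : nat) (P : 'M[R]_n).
Hypothesis P_ge0 : forall i j, 0 <= P i j.
Hypothesis P_le1 : forall i, \sum_j P i j <= 1.
Variables (L : R -> 'cV[R]_n) (M : R).
Hypothesis M_ge0 : 0 <= M.
Hypothesis L0 : L 0 = 0.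
Hypothesis L_incr : forall (u v : R) i, 0 <= u -> u <= v ->
  0 <= L v i 0 - L u i 0 <= M * (v - u).
Variables (zeta : 'cV[R]_n -> 'cV[R]_n) (K : R).
Hypothesis K_ge0 : 0 <= K.
Hypothesis zeta_ge0 : forall x, orthant R n x -> orthant R n (zeta x).
Hypothesis zeta_lip : forall x y, orthant R n x -> orthant R n y ->
  `|zeta x - zeta y| <= K * `|x - y|.
Variable x0 : 'cV[R]_n.
Hypothesis x0_ge0 : orthant R n x0.

(* The cap x_i / h prevents a cell from losing more than its content in one
   step, so that the explicit scheme preserves nonnegativity. *)
Definition euler_outflow (h : R) (x : 'cV[R]_n) : 'cV[R]_n :=
  \col_i Num.min (zeta x i 0) (x i 0 / h).

(** The inflow enters through exact increments of its primitive [L], so pointwise values of [lambda]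
    are never sampled. *)
Fixpoint euler_state (h : R) (k : nat) : 'cV[R]_n :=
  if k is j.+1 then
    euler_state h j + (L (j.+1%:R * h) - L (j%:R * h))
      - h *: ((1%:M - P^T) *m euler_outflow h (euler_state h j))
  else x0.

(** The limit is taken on these cumulated outflows, which are Lipschitz in time uniformly in [h]; no
    time regularity is established for the outflows. *)
Definition euler_total (h : R) (k : nat) : 'cV[R]_n :=
  \sum_(j < k) h *: euler_outflow h (euler_state h j).

Let X := euler_state.
Let W := euler_total.
Let z h k := euler_outflow h (X h k).

Lemma orthant_coord x i : orthant R n x -> 0 <= x i 0.
Proof. by move=> /(_ i); rewrite mxE. Qed.

Lemma routing_le1 i j : P i j <= 1.
Proof. by apply: le_trans (P_le1 i); rewrite (bigD1 j)//= lerDl sumr_ge0. Qed.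

Section step.
Variable h : R.
Hypothesis h_gt0 : 0 < h.

Lemma euler_totalS k i : W h k.+1 i 0 = W h k i 0 + h * z h k i 0.
Proof. by rewrite /W/euler_total big_ord_recr/= mxE [X in _ + X]mxE. Qed.

Lemma euler_stateS k i : X h k.+1 i 0 = X h k i 0
  + (L (k.+1%:R * h) i 0 - L (k%:R * h) i 0)
  - h * (z h k i 0 - \sum_j P j i * z h k j 0).
Proof.
have E (a b c d : 'cV[R]_n) :
    (a + (b - c) - h *: d) i 0 = a i 0 + (b i 0 - c i 0) - h * d i 0.
  by rewrite !mxE.
by rewrite [LHS]E flow_coord.
Qed.

Lemma euler_outflow_le x i :
  euler_outflow h x i 0 <= zeta x i 0 /\ h * euler_outflow h x i 0 <= x i 0.
Proof.
rewrite mxE; split; first by rewrite ge_min lexx.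
by rewrite mulrC -ler_pdivlMr// ge_min lexx orbT.
Qed.

Lemma euler_outflow_ge0 x i : orthant R n x -> 0 <= euler_outflow h x i 0.
Proof.
move=> x_ge0; rewrite mxE le_min; apply/andP; split.
  exact/orthant_coord/zeta_ge0.
by rewrite divr_ge0 ?(ltW h_gt0)//; exact: orthant_coord.
Qed.

Lemma euler_input_ge0 k i :
  0 <= L (k.+1%:R * h) i 0 - L (k%:R * h) i 0 <= M * h.
Proof.
have -> : M * h = M * (k.+1%:R * h - k%:R * h) by rewrite -natr1; ring.
by apply: L_incr; [rewrite mulr_ge0// ltW|rewrite ler_pM2r// ler_nat].
Qed.

Lemma euler_state_ge0 k : orthant R n (X h k).
Proof.
elim: k => [//|k IH] i; rewrite mxE euler_stateS.
have [_ zx] := euler_outflow_le (X h k) i.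
have /andP[L_ge0 _] := euler_input_ge0 k i.
have : 0 <= h * \sum_j P j i * z h k j 0.
  rewrite mulr_ge0 ?(ltW h_gt0)//; apply: sumr_ge0 => j _.
  by rewrite mulr_ge0 ?euler_outflow_ge0.
by move: zx; rewrite -/(z h k); lra.
Qed.

(** Telescoping with [L 0 = 0] gives the discrete form of the integral equation. *)
Lemma euler_stateE k i : X h k i 0 = x0 i 0 + L (k%:R * h) i 0
  - (W h k i 0 - \sum_j P j i * W h k j 0).
Proof.
elim: k => [|k IH].
  have W0 j : W h 0 j 0 = 0 by rewrite /W/euler_total big_ord0 mxE.
  rewrite mul0r L0 W0 big1 => [|j _]; last by rewrite W0 mulr0.
  by rewrite [X in _ + X - _]mxE /X/= addr0 !subr0.
have -> : \sum_j P j i * W h k.+1 j 0 =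
    \sum_j P j i * W h k j 0 + h * \sum_j P j i * z h k j 0.
  rewrite mulr_sumr -big_split/=; apply: eq_bigr => j _.
  by rewrite euler_totalS; ring.
by rewrite euler_stateS IH euler_totalS; ring.
Qed.

Definition mass_bound (T : R) := \sum_i x0 i 0 + n%:R * M * T.

(** Routing creates no mass, so a step adds at most the inflow [M * h] of each of the [n] cells. *)
Lemma euler_mass k : \sum_i X h k i 0 <= mass_bound (k%:R * h).
Proof.
rewrite /mass_bound; elim: k => [|k IH]; first by rewrite !mul0r mulr0 addr0.
under eq_bigr do rewrite euler_stateS.
rewrite sumrB big_split/= -mulr_sumr [X in h * X]sumrB.
have : \sum_i (L (k.+1%:R * h) i 0 - L (k%:R * h) i 0) <= n%:R * (M * h).
  by apply: sum_ord_le => i; have /andP[] := euler_input_ge0 k i.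
have := sum_routed_le P_le1 (fun j => euler_outflow_ge0 j (euler_state_ge0 k)).
rewrite -/(z h k) -natr1 => routed inp.
have : 0 <= h * (\sum_i z h k i 0 - \sum_i \sum_j P j i * z h k j 0).
  by rewrite mulr_ge0 ?(ltW h_gt0)// subr_ge0.
by move: IH inp; set a := \sum_i X _ _ _ _; lra.
Qed.

Definition outflow_bound (T : R) := `|zeta 0| + K * mass_bound T.

Lemma mass_bound_mono (S T : R) : S <= T -> mass_bound S <= mass_bound T.
Proof. by move=> ST; rewrite lerD2l ler_wpM2l// mulr_ge0. Qed.

Lemma mass_bound_ge0 T : 0 <= T -> 0 <= mass_bound T.
Proof.
move=> T0; rewrite addr_ge0 ?mulr_ge0// sumr_ge0// => i _.
exact: orthant_coord.
Qed.

Lemma outflow_bound_ge0 T : 0 <= T -> 0 <= outflow_bound T.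
Proof. by move=> T0; rewrite addr_ge0// mulr_ge0// mass_bound_ge0. Qed.

Lemma euler_outflow_bound T k i : k%:R * h <= T ->
  0 <= z h k i 0 <= outflow_bound T.
Proof.
move=> khT; have Xk := euler_state_ge0 k; rewrite euler_outflow_ge0//=.
have [zz _] := euler_outflow_le (X h k) i; apply: le_trans zz _.
have o0 : orthant R n 0 by move=> j; rewrite lexx.
apply: le_trans (ler_norm _) _; apply: le_trans (normr_coord_le _ _ _) _.
rewrite -(subrK (zeta 0) (zeta (X h k))); apply: le_trans (ler_normD _ _) _.
rewrite addrC lerD2l; apply: le_trans (zeta_lip Xk o0) _.
rewrite subr0 ler_wpM2l//; apply: le_trans (normr_le_sum_coord _) _.
apply: le_trans (mass_bound_mono khT); apply: le_trans (euler_mass k).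
by apply: ler_sum => j _; rewrite ger0_norm// orthant_coord.
Qed.

(** Serves twice: with uniform bounds for the Lipschitz estimate, and with bounds local in time to
    control the derivative of the limit. *)
Lemma euler_total_between (p q : R) j k i : (j <= k)%N ->
  (forall l, (j <= l < k)%N -> p <= z h l i 0 <= q) ->
  p * ((k%:R - j%:R) * h) <= W h k i 0 - W h j i 0 <= q * ((k%:R - j%:R) * h).
Proof.
move=> /subnK <-; elim: (k - j)%N => [|d IH] zpq.
  by rewrite add0n !subrr mul0r !mulr0 lexx.
have /andP[IH1 IH2] : p * (((d + j)%:R - j%:R) * h) <= W h (d + j)%N i 0 - W h j i 0
    <= q * (((d + j)%:R - j%:R) * h).
  apply: IH => l /andP[jl ld]; apply: zpq; rewrite jl/=.
  by rewrite addSn ltnS ltnW.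
have /andP[p1 q1] : p <= z h (d + j)%N i 0 <= q.
  by apply: zpq; rewrite leq_addl addSn ltnS leqnn.
have : h * p <= h * z h (d + j)%N i 0 <= h * q by rewrite !ler_pM2l// p1.
rewrite addSn euler_totalS -natr1 => /andP[? ?].
by apply/andP; split; lra.
Qed.

Lemma euler_total_incr T j k i : (j <= k)%N -> k%:R * h <= T ->
  0 <= W h k i 0 - W h j i 0 <= outflow_bound T * ((k%:R - j%:R) * h).
Proof.
move=> jk kT; have := @euler_total_between 0 (outflow_bound T) j k i jk.
rewrite mul0r; apply => l /andP[jl lk]; apply: euler_outflow_bound.
by apply: le_trans kT; rewrite ler_pM2r// ler_nat ltnW.
Qed.

(** The inflow, the cell's own outflow, and the outflow routed from at most [n] cells with weights
    at most 1. *)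
Definition speed_bound T := M + outflow_bound T * (1 + n%:R).

Lemma euler_state_lip T j k : (j <= k)%N -> k%:R * h <= T ->
  `|X h k - X h j| <= speed_bound T * ((k%:R - j%:R) * h).
Proof.
move=> jk kT.
have jkh : j%:R * h <= k%:R * h by rewrite ler_pM2r// ler_nat.
have jh : 0 <= j%:R * h by rewrite mulr_ge0// ltW.
have S0 : 0 <= outflow_bound T by apply: outflow_bound_ge0; lra.
apply: normr_le_coord => [|i l].
  rewrite mulr_ge0//; last by nra.
  by rewrite addr_ge0// mulr_ge0// addr_ge0.
rewrite ord1 mxE [X in _ + X]mxE !euler_stateE.
have /andP[L1 L2] := L_incr i jh jkh.
have /andP[W1 W2] := euler_total_incr i jk kT.
have : 0 <= \sum_s P s i * (W h k s 0 - W h j s 0) <=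
    n%:R * (outflow_bound T * ((k%:R - j%:R) * h)).
  rewrite sumr_ge0/= => [|s _]; last first.
    by have /andP[W1' _] := euler_total_incr s jk kT; rewrite mulr_ge0.
  apply: sum_ord_le => s.
  have /andP[W1' W2'] := euler_total_incr s jk kT.
  by apply: le_trans W2'; rewrite -[leRHS]mul1r ler_wpM2r// routing_le1.
rewrite (eq_bigr (fun s => P s i * W h k s 0 - P s i * W h j s 0)); last first.
  by move=> s _; ring.
rewrite sumrB ler_norml /speed_bound => /andP[B1 B2].
apply/andP; split; nra.
Qed.

End step.

End euler_scheme.

(** The image of an ultrafilter is an ultrafilter, so it converges in the compact segment. *)
Lemma ultra_bounded_limit (R : realType) (U : set_system nat) (w : nat -> R)
    (a b : R) : UltraFilter U -> (forall m, a <= w m <= b) ->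
  exists l : R, forall e : R, 0 < e -> U [set m | `|l - w m| <= e].
Proof.
move=> UU wab; have PU : ProperFilter U by exact: ultra_proper.
have wU : UltraFilter (w @ U).
  split=> [|G PG UG]; first exact: fmap_proper_filter.
  apply/seteqP; split => // A GA /=.
  have [//|UA] := in_ultra_setVsetC (w @^-1` A) UU.
  have /filter_ex[t []//] : G (A `&` ~` A).
  by apply: filterI => //; apply: UG; exact: UA.
have := @segment_compact R a b; rewrite compact_ultra => /(_ _ wU).
case; first by apply: (@filterE _ U) => m /=; rewrite in_itv/= wab.
move=> l [_ wl]; exists l => e e0.
by have /cvgrPdist_le := wl; apply.
Qed.

(** * Passage to the limit in the scheme *)

Section euler_limit.
Variables (R : realType) (n : nat) (P : 'M[R]_n).
Hypothesis P_ge0 : forall i j, 0 <= P i j.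
Hypothesis P_le1 : forall i, \sum_j P i j <= 1.
Variables (L : R -> 'cV[R]_n) (M : R).
Hypothesis M_ge0 : 0 <= M.
Hypothesis L0 : L 0 = 0.
Hypothesis L_incr : forall (u v : R) i, 0 <= u -> u <= v ->
  0 <= L v i 0 - L u i 0 <= M * (v - u).
Variables (zeta : 'cV[R]_n -> 'cV[R]_n) (K : R).
Hypothesis K_ge0 : 0 <= K.
Hypothesis zeta_ge0 : forall x, orthant R n x -> orthant R n (zeta x).
Hypothesis zeta_lip : forall x y, orthant R n x -> orthant R n y ->
  `|zeta x - zeta y| <= K * `|x - y|.
Variable x0 : 'cV[R]_n.
Hypothesis x0_ge0 : orthant R n x0.
Variable U : set_system nat.
Hypothesis U_ultra : UltraFilter U.
Hypothesis U_oo : \oo `<=` U.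

Let U_I A B : U A -> U B -> U (A `&` B). Proof. exact: filterI. Qed.
Let U_ex A : U A -> exists m, A m. Proof. exact: filter_ex. Qed.
Let h m : R := m.+1%:R^-1.
(** The number of the step containing [t]. It is 0 for negative times, so the limit is defined on
    the whole line and vanishes before 0. *)
Let idx m (t : R) := Num.trunc (t * m.+1%:R).
Let X m := euler_state P L zeta x0 (h m).
Let W m := euler_total P L zeta x0 (h m).
Let z m k := euler_outflow zeta (h m) (X m k).
Let Q := outflow_bound M zeta K x0.

Let h_gt0 m : 0 < h m. Proof. by rewrite invr_gt0. Qed.
#[local] Hint Resolve h_gt0 : core.

Let h_small e : 0 < e -> U [set m | h m < e].
Proof. by move=> e0; apply: U_oo; exact: (near_infty_natSinv_lt (PosNum e0)). Qed.

Let idx_itv m t : 0 <= t -> (idx m t)%:R * h m <= t < (idx m t)%:R * h m + h m.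
Proof.
move=> t0; have /andP[i1 i2] := truncn_itv (mulr_ge0 t0 (ler0n R m.+1)).
rewrite /h -[X in _ < _ + X]mul1r -mulrDl natr1.
by rewrite ler_pdivrMr// ltr_pdivlMr// i1.
Qed.

Let idx_le0 m t : t <= 0 -> idx m t = 0%N.
Proof.
move=> t0; apply/truncn0Pn; rewrite -ltNge.
by apply: le_lt_trans ltr01; rewrite mulr_le0_ge0.
Qed.

Let idx_mono m s t : s <= t -> (idx m s <= idx m t)%N.
Proof. by move=> st; apply: le_truncn; rewrite ler_wpM2r. Qed.

Let X_ge0 m k : orthant R n (X m k).
Proof. exact: (euler_state_ge0 P_ge0 L_incr zeta_ge0 x0_ge0). Qed.

Let total_bound m t i : 0 <= W m (idx m t) i 0 <= Q (Num.max t 0) * Num.max t 0.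
Proof.
have W0 : W m 0%N i 0 = 0 by rewrite /W/euler_total big_ord0 mxE.
have m0 : 0 <= Num.max t 0 by rewrite le_max lexx orbT.
have Q0 : 0 <= Q (Num.max t 0) by exact: outflow_bound_ge0.
have [t0|t0] := leP t 0; first by rewrite idx_le0// W0 mulr0 lexx.
have /andP[it _] := idx_itv m (ltW t0).
have := @euler_total_incr R n P P_ge0 P_le1 L M M_ge0 L_incr zeta K K_ge0
  zeta_ge0 zeta_lip x0 x0_ge0 (h m) (h_gt0 m) t 0 (idx m t) i (leq0n _) it.
rewrite -/(W m) W0 !subr0 => /andP[-> /le_trans]; apply.
by rewrite ler_wpM2l// outflow_bound_ge0// ltW.
Qed.

Let limit_exists : exists Z : R -> 'cV[R]_n, forall (t : R) i (e : R), 0 < e ->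
  U [set m | `|Z t i 0 - W m (idx m t) i 0| <= e].
Proof.
have /choice[Z ZP] (p : R * 'I_n) : exists l : R, forall e : R, 0 < e ->
    U [set m | `|l - W m (idx m p.1) p.2 0| <= e].
  exact: ultra_bounded_limit U_ultra (fun m => total_bound m p.1 p.2).
by exists (fun t => \col_i Z (t, i)) => t i e e0; rewrite mxE; exact: (ZP (t, i)).
Qed.

(* Convergence along an ultrafilter replaces the extraction of a subsequence:
   pointwise limits always exist, and the uniform Lipschitz bounds make them
   locally uniform. *)
Lemma euler_limit : exists Z : R -> 'cV[R]_n,
  let x t := x0 + L t - (1%:M - P^T) *m Z t in
  [/\ forall t : R, t <= 0 -> Z t = 0,
      forall (T u v : R) i, 0 <= u -> u <= v -> v <= T ->
        0 <= Z v i 0 - Z u i 0 <= Q T * (v - u),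
      forall t : R, 0 <= t -> orthant R n (x t),
      forall (t : R) i (q : R), 0 <= t -> zeta (x t) i 0 < q ->
        exists2 d : R, 0 < d &
        forall s v : R, 0 <= s -> s <= t <= v -> v - s < d ->
        Z v i 0 - Z s i 0 <= q * (v - s) &
      forall (t : R) i (q : R), 0 <= t -> 0 < x t i 0 -> q < zeta (x t) i 0 ->
        exists2 d : R, 0 < d &
        forall s v : R, 0 <= s -> s <= t <= v -> v - s < d ->
        q * (v - s) <= Z v i 0 - Z s i 0].
Proof.
have [Z ZP] := limit_exists; exists Z => x.
have between (p q : R) i (s v : R) : 0 <= s -> s <= v ->
    U [set m | forall l, (idx m s <= l < idx m v)%N -> p <= z m l i 0 <= q] ->
    p * (v - s) <= Z v i 0 - Z s i 0 <= q * (v - s).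
  move=> s0 sv Uz; have v0 := le_trans s0 sv.
  have close (e : R) : 0 < e -> exists m,
      [/\ forall l, (idx m s <= l < idx m v)%N -> p <= z m l i 0 <= q, h m < e,
        `|Z s i 0 - W m (idx m s) i 0| <= e & `|Z v i 0 - W m (idx m v) i 0| <= e].
    move=> e0.
    have /U_ex[m [? [? [? ?]]]] :=
      U_I Uz (U_I (h_small e0) (U_I (ZP s i e e0) (ZP v i e e0))).
    by exists m; split.
  suff approx (e : R) : 0 < e ->
      p * (v - s) - e <= Z v i 0 - Z s i 0 <= q * (v - s) + e.
    apply/andP; split; apply/ler_addgt0Pr => e e0;
      have /andP[] := approx e e0 => //.
    by rewrite lerBlDr.
  (* The 2 pays for replacing [Z] by the totals at both ends; [|p|] and [|q|] pay for rounding
     [v - s] to a multiple of the step. *)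
  move=> e0; pose c := 2 + `|p| + `|q|.
  have c0 : 0 < c by rewrite /c !ltr_wpDr.
  have [m [zm hm Zs Zv]] := close (e / c) (divr_gt0 e0 c0).
  have ecE : e / c * (2 + `|p| + `|q|) = e by rewrite divfK// gt_eqF.
  have /andP[s1 s2] := idx_itv m s0; have /andP[v1 v2] := idx_itv m v0.
  have := @euler_total_between R n P L zeta x0 (h m) (h_gt0 m) p q _ _ i
    (idx_mono m sv) zm.
  rewrite -/(W m) => /andP[W1 W2].
  have sgn (r : R) : `|r * (((idx m v)%:R - (idx m s)%:R) * h m - (v - s))| <=
      `|r| * (e / c).
    rewrite normrM ler_wpM2l// ler_norml; apply/andP; split; move: s1 s2 v1 v2 hm.
      by set a := _%:R; set b := _%:R; nra.
    by set a := _%:R; set b := _%:R; nra.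
  have := sgn p; have := sgn q; move: Zs Zv.
  rewrite !ler_norml => /andP[? ?] /andP[? ?] /andP[? ?] /andP[? ?].
  by apply/andP; split; lra.
have near_state (t e : R) : 0 <= t -> 0 < e -> exists2 d : R, 0 < d &
    U [set m | forall j, `|j%:R * h m - t| < d -> `|X m j - x t| <= e].
  move=> t0 e0; pose S := speed_bound M zeta K x0 (t + 1).
  have S0 : 0 <= S.
    have Q0 : 0 <= Q (t + 1) by apply: outflow_bound_ge0 => //; rewrite addr_ge0.
    by rewrite addr_ge0// mulr_ge0// addr_ge0.
  (* The error at step [idx m t] is at most [e1] times [M] for the inflow, 1 for the own outflow and
     [n] for the routed one: [e / 2] in all. *)
  pose c : R := 2 * (n%:R + M + 1).
  have c0 : 0 < c by rewrite /c; have := ler0n R n; move: M_ge0; lra.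
  pose e1 := e / c; have e10 : 0 < e1 by rewrite divr_gt0.
  have e1E : e1 * (2 * (n%:R + M + 1)) = e by rewrite /e1 divfK// gt_eqF.
  (* [d <= 1] stays in the range where [S] bounds the speed; two step times within [d] of [t] are at
     most [2 * d] apart, which costs at most [e / 2]. *)
  pose d := Num.min 1 (e / (4 * (S + 1))).
  have S4 : 0 < 4 * (S + 1) by lra.
  have d0 : 0 < d by rewrite lt_min ltr01 divr_gt0.
  have d1 : d <= 1 by rewrite ge_min lexx.
  have dS : d * (4 * (S + 1)) <= e.
    by rewrite -ler_pdivlMr// ge_min lexx orbT.
  exists d => //.
  have UZ : U [set m | forall i, `|Z t i 0 - W m (idx m t) i 0| <= e1].
    apply: filter_forall => i; exact: ZP.
  apply: filterS3 UZ (h_small e10) (h_small d0) => m /= Zm he hd j jd.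
  have /andP[i1 i2] := idx_itv m t0.
  have ih0 : 0 <= (idx m t)%:R * h m by rewrite mulr_ge0// ltW.
  have Xidx : `|X m (idx m t) - x t| <= e / 2.
    apply: normr_le_coord => [|i l]; first by rewrite divr_ge0// ltW.
    rewrite ord1 mxE [X in _ + X]mxE /X (euler_stateE P L0 zeta x0).
    have -> : x t i 0 = x0 i 0 + L t i 0 - (Z t i 0 - \sum_s P s i * Z t s 0).
      by rewrite /x mxE [X in X + _]mxE [X in _ + X]mxE flow_coord.
    have := L_incr i ih0 i1.
    have : `|\sum_s P s i * (Z t s 0 - W m (idx m t) s 0)| <= n%:R * e1.
      apply: le_trans (ler_norm_sum _ _ _) _; apply: sum_ord_le => s.
      rewrite normrM ger0_norm//; apply: le_trans (Zm s).
      by rewrite -[leRHS]mul1r ler_wpM2r// routing_le1.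
    rewrite (eq_bigr (fun s => P s i * Z t s 0 - P s i * W m (idx m t) s 0)); last first.
      by move=> s _; ring.
    have MM : M * (t - (idx m t)%:R * h m) <= M * e1 by rewrite ler_wpM2l//; lra.
    rewrite sumrB; have := Zm i; rewrite -/(W m) !ler_norml.
    move=> /andP[? ?] /andP[? ?] /andP[? ?].
    by apply/andP; split; lra.
  have Xj : `|X m j - X m (idx m t)| <= e / 2.
    have lip a b : (a <= b)%N -> b%:R * h m <= t + 1 ->
        b%:R * h m - a%:R * h m <= 2 * d -> `|X m b - X m a| <= e / 2.
      move=> ab bt bad.
      apply: le_trans (euler_state_lip P_ge0 P_le1 M_ge0 L0 L_incr K_ge0
        zeta_ge0 zeta_lip x0_ge0 (h_gt0 m) ab bt) _.
      rewrite mulrBl -/S; apply: le_trans (ler_wpM2l S0 bad) _; nra.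
    move: jd; rewrite ltr_norml => /andP[j1 j2].
    have [jt|tj] := leqP j (idx m t).
      by rewrite distrC; apply: lip => //; lra.
    by apply: lip; [exact: ltnW|lra|lra].
  rewrite -(subrK (X m (idx m t)) (X m j)) -addrA.
  by apply: le_trans (ler_normD _ _) _; lra.
have x_ge0 (t : R) : 0 <= t -> orthant R n (x t).
  move=> t0 i; rewrite mxE; apply/ler_addgt0Pr => e e0.
  have [d d0 Xd] := near_state t e t0 e0.
  have /U_ex[m [hd Xm]] := U_I (h_small d0) Xd.
  have /andP[i1 i2] := idx_itv m t0.
  have := Xm (idx m t); rewrite /= ler0_norm; last by lra.
  move=> /(_ ltac:(move: hd => /=; lra)) Xe.
  have Xi : 0 <= X m (idx m t) i 0.
    exact/orthant_coord/X_ge0.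
  have := le_trans (normr_coord_le _ i 0) Xe; rewrite mxE [X in _ + X]mxE.
  by rewrite ler_norml => /andP[_ ?]; lra.
(* Half of [d] covers the interval around [t], and the other half covers rounding down to a step
   time. *)
have near_range (t d : R) : 0 <= t -> 0 < d ->
    U [set m | forall (s v : R) l, 0 <= s -> s <= t <= v -> v - s < d / 2 ->
      (idx m s <= l < idx m v)%N -> `|l%:R * h m - t| < d].
  move=> t0 d0; have d20 : 0 < d / 2 by rewrite divr_gt0.
  apply: filterS (h_small d20) => m /= hd s v l s0 /andP[st tv] vs /andP[sl lv].
  have /andP[_ is2] := idx_itv m s0.
  have /andP[iv1 _] := idx_itv m (le_trans s0 (le_trans st tv)).
  have : (idx m s)%:R * h m <= l%:R * h m by rewrite ler_pM2r// ler_nat.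
  have : l%:R * h m <= (idx m v)%:R * h m by rewrite ler_pM2r// ler_nat ltnW.
  by move=> *; rewrite ltr_norml; apply/andP; split; lra.
have zeta_near m j (t e : R) i : 0 <= t -> `|X m j - x t| <= e ->
    `|zeta (X m j) i 0 - zeta (x t) i 0| <= K * e.
  move=> t0 Xe; apply: le_trans (_ : `|zeta (X m j) - zeta (x t)| <= _).
    by have := normr_coord_le (zeta (X m j) - zeta (x t)) i 0; rewrite !mxE.
  apply: le_trans (zeta_lip _ (x_ge0 _ t0)) _; first exact: X_ge0.
  by rewrite ler_wpM2l.
have z_bound (T : R) m l i : l%:R * h m <= T -> 0 <= z m l i 0 <= Q T.
  by apply: (@euler_outflow_bound R n P P_ge0 P_le1 L M M_ge0 L_incr zeta K K_ge0).
split=> //.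
- move=> t t0; apply/matrixP => i j.
  rewrite ord1 mxE; apply/eqP; rewrite -normr_le0.
  apply/ler_addgt0Pr => e e0; rewrite add0r.
  have /U_ex[m /=] := ZP t i e e0; rewrite idx_le0//.
  by rewrite /W /euler_total big_ord0 mxE subr0.
- move=> T u v i u0 uv vT.
  have -> : (0 <= Z v i 0 - Z u i 0) = (0 * (v - u) <= Z v i 0 - Z u i 0).
    by rewrite mul0r.
  apply: between => //; apply: filterE => m l /andP[_ lv].
  apply: z_bound; apply: le_trans vT.
  have /andP[iv1 _] := idx_itv m (le_trans u0 uv); apply: le_trans iv1.
  by rewrite ler_pM2r// ler_nat ltnW.
- move=> t i q t0 zq.
  have e0 : 0 < (q - zeta (x t) i 0) / (K + 1).
    by rewrite divr_gt0 ?subr_gt0// ltr_wpDl.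
  have eE : (q - zeta (x t) i 0) / (K + 1) * (K + 1) = q - zeta (x t) i 0.
    by rewrite divfK// gt_eqF// ltr_wpDl.
  move: e0 eE; set e := _ / _ => e0 eE.
  have [d d0 Xd] := near_state t e t0 e0.
  exists (d / 2) => [|s v s0 stv vs]; first by rewrite divr_gt0.
  have /andP[st tv] := stv.
  have /(between 0 q i s v s0 (le_trans st tv))/andP[] // :
      U [set m | forall l, (idx m s <= l < idx m v)%N ->
      0 <= z m l i 0 <= q].
  apply: filterS2 Xd (near_range t d t0 d0) => m Xm range l lsv.
  have := zeta_near m l t e i t0 (Xm l (range s v l s0 stv vs lsv)).
  have [+ _] := @euler_outflow_le R n zeta (h m) (h_gt0 m) (X m l) i.
  rewrite -/(z m l) ler_norml => ? /andP[? ?].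
  have Xl := X_ge0 m l.
  by rewrite euler_outflow_ge0//=; nra.
- move=> t i q t0 xt zq.
  (* For negative [q] monotonicity of [Z] suffices; afterwards [q + 1] is a positive denominator. *)
  have [q0|q0] := ltP q 0.
    exists 1 => // s v s0 /andP[st tv] _; apply: (@le_trans _ _ 0); first by nra.
    have /(between 0 (Q v) i s v s0 (le_trans st tv))/andP[] // :
        U [set m | forall l, (idx m s <= l < idx m v)%N ->
      0 <= z m l i 0 <= Q v].
      apply: filterE => m l /andP[_ lv]; apply: z_bound.
      have /andP[iv1 _] := idx_itv m (le_trans s0 (le_trans st tv)).
      by apply: le_trans iv1; rewrite ler_pM2r// ler_nat ltnW.
    by rewrite mul0r.
  pose e1 := (zeta (x t) i 0 - q) / (K + 1).
  have e10 : 0 < e1 by rewrite divr_gt0 ?subr_gt0// ltr_wpDl.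
  have e1E : e1 * (K + 1) = zeta (x t) i 0 - q by rewrite divfK// gt_eqF// ltr_wpDl.
  pose e := Num.min e1 (x t i 0 / 2).
  have e0 : 0 < e by rewrite lt_min e10 divr_gt0.
  have ee1 : e <= e1 by rewrite ge_min lexx.
  have ex2 : e <= x t i 0 / 2 by rewrite ge_min lexx orbT.
  have [d d0 Xd] := near_state t e t0 e0.
  exists (d / 2) => [|s v s0 stv vs]; first by rewrite divr_gt0.
  have /andP[st tv] := stv.
  have /(between q (Q v) i s v s0 (le_trans st tv))/andP[] // :
      U [set m | forall l, (idx m s <= l < idx m v)%N ->
      q <= z m l i 0 <= Q v].
  (* Nearby scheme states keep at least half of [x t i 0], so for [h] below this threshold the cap
     [x_i / h] exceeds [q]. *)
  have hx0 : 0 < x t i 0 / 2 / (q + 1) by rewrite !divr_gt0// ltr_wpDl.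
  apply: filterS3 Xd (near_range t d t0 d0) (h_small hx0) => m Xm range /= hx l lsv.
  have Xe := Xm l (range s v l s0 stv vs lsv).
  have /andP[_ ->] : 0 <= z m l i 0 <= Q v.
    apply: z_bound; have /andP[iv1 _] := idx_itv m (le_trans s0 (le_trans st tv)).
    apply: le_trans iv1; have /andP[_ lv] := lsv.
    by rewrite ler_pM2r// ler_nat ltnW.
  rewrite andbT /z mxE le_min; apply/andP; split.
    have := zeta_near m l t e i t0 Xe; rewrite ler_norml => /andP[? ?].
    have : K * e <= K * e1 by rewrite ler_wpM2l.
    by lra.
  rewrite ler_pdivlMr//.
  have := le_trans (normr_coord_le _ i 0) Xe; rewrite mxE [X in _ + X]mxE.
  rewrite ler_norml => /andP[? _].
  move: hx; rewrite ltr_pdivlMr ?ltr_wpDl// => hx.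
  have := h_gt0 m; nra.
Qed.

End euler_limit.

(** * Existence *)

Lemma lipschitz_absolutely_continuous (R : realType) (V : normedModType R)
    (a b C : R) (f : R -> V) :
  (forall u v : R, a <= u -> u <= v -> v <= b -> `|f v - f u| <= C * (v - u)) ->
  absolutely_continuous a b f.
Proof.
move=> fC e e0; have C0 : 0 < `|C| + 1 by rewrite ltr_wpDl.
exists (e / (`|C| + 1)) => [|m B BI _ Bd]; first by rewrite divr_gt0.
move: Bd; rewrite ltr_pdivlMr// mulrC; apply: le_lt_trans.
rewrite mulr_sumr; apply: ler_sum => k _; have [B12 Bab] := BI k.
have Ba : a <= (B k).1.
  by have := Bab (B k).1; rewrite /= !in_itv/= lexx B12 => /(_ isT)/andP[].
have Bb : (B k).2 <= b.
  by have := Bab (B k).2; rewrite /= !in_itv/= lexx B12 => /(_ isT)/andP[].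
apply: le_trans (fC _ _ Ba B12 Bb) _; rewrite ler_wpM2r ?subr_ge0//.
by apply: le_trans (ler_norm _) _; rewrite lerDl.
Qed.

Lemma is_derive_col (R : realType) n (x : R -> 'cV[R]_n) (t : R) (v : 'cV[R]_n) :
  (forall i, is_derive t 1 (fun s => x s i 0) (v i 0)) -> is_derive t 1 x v.
Proof.
move=> dx; have derx : derivable x t 1.
  by apply/derivable_mxP => i j; rewrite ord1; have [] := dx i.
split=> //; apply/matrixP => i j; rewrite derive_mx// mxE ord1.
by have [_ ->] := dx i.
Qed.

(** Since the derivative exists, increments to the right determine it; applied to the negated
    function this also gives lower bounds. *)
Lemma is_derive_right_le (R : realType) (f : R -> R) (t D q d : R) :
  is_derive t 1 f D -> 0 < d ->
  (forall v : R, t <= v -> v - t < d -> f v - f t <= q * (v - t)) -> D <= q.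
Proof.
move=> /is_derive_linear_approx fD d0 fq; apply/ler_addgt0Pr => e e0.
have [d' d'0 fd'] := fD e e0.
pose c := Num.min (d / 2) (d' / 2).
have c0 : 0 < c by rewrite lt_min !divr_gt0.
have cd : c < d by rewrite gt_min; apply/orP; left; lra.
have cd' : c < d' by rewrite gt_min; apply/orP; right; lra.
clearbody c.
have := fd' (t + c); have := fq (t + c); rewrite (addrC t) addrK gtr0_norm//.
move=> /(_ ltac:(lra) cd) fc /(_ cd'); rewrite ler_norml => /andP[? _].
by rewrite -(ler_pM2l c0); lra.
Qed.

(** Clamping time to [[0, k]] and dividing by a Lipschitz constant reduces this to
    [contraction_ae_derivable]. *)
Lemma ae_derivable_local (R : realType) (F : R -> R) (C : R -> R) :
  (forall T u v : R, 0 <= u -> u <= v -> v <= T ->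
    0 <= F v - F u <= C T * (v - u)) ->
  {ae @lebesgue_measure R, forall t : R, 0 < t -> derivable F t 1}.
Proof.
move=> FC; have FF : Filter (almost_everywhere (@lebesgue_measure R)).
  exact: ae_filter_ringOfSetsType.
suff k_ae k : {ae @lebesgue_measure R,
    forall t : R, 0 < t < k%:R -> derivable F t 1}.
  have := @negligible_bigcup _ _ _ (@lebesgue_measure R) _ k_ae.
  apply: negligibleS => t /= Ft; exists (Num.bound t) => //= H; apply: Ft => t0.
  by apply: H; rewrite t0 archi_boundP// ltW.
pose c := `|C k%:R| + 1; have c0 : 0 < c by rewrite ltr_wpDl.
pose clamp (t : R) : R := Num.min (Num.max t 0) k%:R.
pose G t := c^-1 * F (clamp t).
have clampP u v : u <= v -> [/\ 0 <= clamp u, clamp u <= clamp v, clamp v <= k%:R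
    & clamp v - clamp u <= v - u].
  move=> uv; have k0 := ler0n R k; rewrite /clamp.
  by case: (leP u 0); case: (leP v 0); case: (leP u k%:R); case: (leP v k%:R);
    move=> *; split; rewrite ?minEle ?maxEle; do ?case: ifPn => ?; lra.
have Gnd u v : u <= v -> G u <= G v.
  move=> uv; have [c1 c2 c3 _] := clampP _ _ uv.
  have /andP[+ _] := FC _ _ _ c1 c2 c3.
  by rewrite subr_ge0 ler_pM2l// invr_gt0.
have Gcontr u v : u <= v -> G v - G u <= v - u.
  move=> uv; have [c1 c2 c3 c4] := clampP _ _ uv.
  have /andP[_ Fuv] := FC _ _ _ c1 c2 c3.
  rewrite /G -mulrBr mulrC ler_pdivrMr//; apply: le_trans Fuv _.
  have : C k%:R <= c by rewrite /c (le_trans (ler_norm _))// lerDl.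
  by nra.
apply: filterS (contraction_ae_derivable Gnd Gcontr) => t Gt /andP[t0 tk].
have : derivable (c *: G) t 1 by apply: derivableZ.
apply: near_eq_derivable; near=> s.
have s0 : 0 < s by near: s; exact: lt_nbhsr.
have sk : s < k%:R by near: s; exact: lt_nbhsl.
rewrite /G /clamp fctE /GRing.scale/= mulrA divff ?gt_eqF// mul1r.
by rewrite max_l ?ltW// min_l ?ltW.
Unshelve. all: by end_near. Qed.

Section derivative_limsup.
Variables (R : realType) (F : R -> R).

(* A representative of the derivative that is measurable whether or not F is
   derivable. *)
Definition upper_quotient_limit (t : R) : R :=
  limn_sup (fun m => m.+1%:R * (F (t + m.+1%:R^-1) - F t)).

Lemma is_derive_upper_quotient_limit (t D : R) : is_derive t 1 F D ->
  upper_quotient_limit t = D.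
Proof.
move=> /is_derive_linear_approx FD; apply/cvg_lim => //; apply: cvg_sups.
apply/cvgrPdist_le => e e0; have [d d0 Fd] := FD e e0.
near=> m.
have md : m.+1%:R^-1 < d by near: m; exact: (near_infty_natSinv_lt (PosNum d0)).
have m0 : 0 < m.+1%:R :> R by [].
move: m0 md; set q := m.+1%:R => q0 qd.
have := Fd (t + q^-1); rewrite (_ : t + q^-1 - t = q^-1); last by ring.
rewrite gtr0_norm ?invr_gt0// => /(_ qd).
rewrite -(ler_pM2l q0) mulrCA divff ?gt_eqF// mulr1.
rewrite -[X in X * `|_| <= _](gtr0_norm q0) -normrM => /(le_trans _); apply.
rewrite -[X in X <= _]normrN le_eqVlt; apply/orP; left; apply/eqP; congr (`|_|).
by field; rewrite gt_eqF.
Unshelve. all: by end_near. Qed.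

(** The quotients are continuous in [t], and the Lipschitz bound keeps them bounded at each [t], as
    a real-valued upper limit requires. *)
Lemma measurable_upper_quotient_limit (C : R -> R) :
  (forall T u v : R, 0 <= T -> u <= v -> v <= T ->
    0 <= F v - F u <= C T * (v - u)) ->
  measurable_fun setT
    (upper_quotient_limit : measurableTypeR R -> measurableTypeR R).
Proof.
move=> FC.
have Fcont : continuous F.
  move=> t; apply/cvgrPdist_le => e e0; pose T := `|t| + 1.
  have tT : t + 1 <= T by rewrite lerD2r ler_norm.
  have T0 : 0 <= T by rewrite addr_ge0.
  have c0 : 0 < `|C T| + 1 by rewrite ltr_wpDl.
  near=> s.
  have st1 : s <= t + 1 by near: s; apply: lt_le_nbhsl; rewrite ltrDl.
  have Fst u v : u <= v -> v <= t + 1 -> `|F v - F u| <= (`|C T| + 1) * (v - u).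
    move=> uv vt; have /andP[F1 F2] := FC T u v T0 uv (le_trans vt tT).
    rewrite ger0_norm//; apply: le_trans F2 _; rewrite ler_wpM2r ?subr_ge0//.
    by apply: le_trans (ler_norm _) _; rewrite lerDl.
  have : `|t - s| <= e / (`|C T| + 1).
    by near: s; apply: cvgr_dist_le; [exact: cvg_id|rewrite divr_gt0].
  rewrite ler_pdivlMr// mulrC; apply: le_trans.
  have [ts|st] := leP s t.
    by rewrite [X in _ <= _ * X]ger0_norm ?subr_ge0// Fst// lerDl.
  rewrite distrC [X in _ <= _ * X]distrC [X in _ <= _ * X]gtr0_norm ?subr_gt0//.
  by rewrite Fst// ltW.
have qb (t : R) : exists b,
    forall m : nat, 0 <= m.+1%:R * (F (t + m.+1%:R^-1) - F t) <= b.
  exists (C (`|t| + 1)) => m.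
  have m1 : m.+1%:R^-1 <= 1 :> R by rewrite invf_le1// ler1n.
  have mi : 0 < m.+1%:R^-1 :> R by rewrite invr_gt0.
  have /andP[F1 F2] : 0 <= F (t + m.+1%:R^-1) - F t <=
      C (`|t| + 1) * (t + m.+1%:R^-1 - t).
    by apply: FC; [rewrite addr_ge0|rewrite lerDl ltW|rewrite lerD// ler_norm].
  rewrite mulr_ge0//=; move: F2; rewrite (addrC t) addrK.
  by rewrite -(ler_pM2l (ltr0Sn R m)) mulrCA divff ?pnatr_eq0// mulr1.
apply: measurable_fun_limn_sup.
- move=> t _; have [b qb'] := qb t; exists b => _ [m _ <-].
  by have /andP[] := qb' m.
- move=> t _; have [b qb'] := qb t; exists 0 => _ [m _ <-].
  by have /andP[] := qb' m.
- move=> m; apply: measurable_funM => //; apply: measurable_funB; last first.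
    exact: continuous_measurable_fun.
  apply: continuous_measurable_fun => t.
  apply: continuous_comp; last exact: Fcont.
  by apply: cvgD; [exact: cvg_id|exact: cvg_cst].
Unshelve. all: by end_near. Qed.

End derivative_limsup.

Section existence.
Variables (R : realType) (n : nat) (P : 'M[R]_n).
Hypothesis P_ge0 : forall i j, 0 <= P i j.
Hypothesis P_le1 : forall i, \sum_j P i j <= 1.
Variables (lambda : R -> 'cV[R]_n) (zeta : 'cV[R]_n -> 'cV[R]_n).
Hypothesis lambda_ge0 : forall t : R, 0 <= t -> orthant R n (lambda t).
Hypothesis lambda_bounded : [bounded lambda t | t in `[0, +oo[%classic].
Hypothesis lambda_measurable : lebesgue_measurable `[0, +oo[%classic lambda.
Hypothesis zeta_ge0 : forall x, orthant R n x -> orthant R n (zeta x).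
Hypothesis zeta_lipschitz : [lipschitz zeta x | x in orthant R n].
Variable x0 : 'cV[R]_n.
Hypothesis x0_ge0 : orthant R n x0.

Lemma bounded_inflow_primitive : exists (M : R) (L : R -> 'cV[R]_n),
  [/\ 0 <= M, L 0 = 0,
      forall (u v : R) i, 0 <= u -> u <= v ->
        0 <= L v i 0 - L u i 0 <= M * (v - u) &
      {ae @lebesgue_measure R, forall t : R, 0 <= t ->
        forall i, is_derive t 1 (fun s => L s i 0) (lambda t i 0)}].
Proof.
have [M [M0 lM]] : exists M : R, 0 <= M /\ forall t : R, 0 <= t -> `|lambda t| <= M.
  have : \forall M \near +oo, 0 <= M /\ forall t : R, 0 <= t -> `|lambda t| <= M.
    apply: filterS2 (nbhs_pinfty_ge (@real0 R)) lambda_bounded => M M0 lM.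
    by split => // t t0; apply: lM; rewrite /= in_itv/= t0.
  by move=> /filter_ex.
have l_bound i (t : R) : 0 <= t -> 0 <= lambda t i 0 <= M.
  move=> t0; rewrite (orthant_coord i (lambda_ge0 t0))/=.
  apply: le_trans (ler_norm _) _; apply: le_trans (normr_coord_le _ _ _) _.
  exact: lM.
have /choice[L LP] i :=
  bounded_measurable_primitive (lambda_measurable i) (l_bound i).
exists M, (fun t => \col_i L i t); split => //.
- by apply/matrixP => i j; rewrite !mxE; have [] := LP i.
- by move=> u v i u0 uv; rewrite !mxE; have [_ Li _] := LP i; exact: Li.
have FF : Filter (almost_everywhere (@lebesgue_measure R)).
  exact: ae_filter_ringOfSetsType.
have : {ae @lebesgue_measure R, forall t : R, forall i, 0 <= t ->
    is_derive t 1 (L i) (lambda t i 0)}.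
  by apply: filter_forall => i; have [] := LP i.
apply: filterS => t Lt t0 i; under eq_fun do rewrite mxE.
exact: Lt.
Qed.

Lemma solution_exists : exists x z, is_solution P lambda zeta `[0, +oo[ x0 x z.
Proof.
have [M [L [M0 L0 L_incr Lder]]] := bounded_inflow_primitive.
have [K K0 zeta_lip] := lipschitz_orthantP zeta_lipschitz.
have [U [UU Uoo]] := @ultraFilterLemma nat \oo _.
have := @euler_limit R n P P_ge0 P_le1 L M M0 L0 L_incr zeta K K0 zeta_ge0 zeta_lip
  x0 x0_ge0 U UU Uoo.
set Q := outflow_bound M zeta K x0.
move=> [Z]; set x := fun t => _; move=> [Zle0 Z_incr x_ge0 upper lower].
pose z t : 'cV[R]_n := \col_i upper_quotient_limit (fun s => Z s i 0) t.
have FF : Filter (almost_everywhere (@lebesgue_measure R)).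
  exact: ae_filter_ringOfSetsType.
(* Measurability is proved on the whole line, so the bounds are extended to negative times, where
   [Z] is zero. *)
have Z_incrR i (T u v : R) : 0 <= T -> u <= v -> v <= T ->
    0 <= Z v i 0 - Z u i 0 <= Q T * (v - u).
  move=> T0 uv vT; have Q0 : 0 <= Q T by exact: outflow_bound_ge0.
  have [u0|u0] := leP 0 u; first exact: Z_incr.
  have Zu : Z u i 0 = Z 0 i 0 by rewrite (Zle0 u (ltW u0)) Zle0.
  have [v0|v0] := leP 0 v; last first.
    by rewrite (Zle0 v (ltW v0)) (Zle0 u (ltW u0)) subrr lexx mulr_ge0// subr_ge0.
  have /andP[Z1 Z2] := Z_incr T 0 v i (lexx 0) v0 vT.
  rewrite Zu Z1/=; apply: le_trans Z2 _; rewrite ler_wpM2l//; lra.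
exists x, z; split.
- split; last by rewrite /x L0 Zle0// mulmx0 addr0 subr0.
  move=> a b ab abJ; have a0 : 0 <= a.
    have : [set` `[0, +oo[] a by apply: abJ; rewrite /= in_itv/= lexx.
    by rewrite /= in_itv/= andbT.
  have Qb : 0 <= Q b by apply: outflow_bound_ge0 => //; exact: le_trans ab.
  apply: (@lipschitz_absolutely_continuous R _ a b (M + Q b * (1 + n%:R))).
  move=> u v au uv vb; have u0 := le_trans a0 au.
  have MQ : 0 <= M + Q b * (1 + n%:R) by rewrite addr_ge0// mulr_ge0// addr_ge0.
  apply: normr_le_coord => [|i j]; first by rewrite mulr_ge0// subr_ge0.
  rewrite ord1 {MQ}.
  have xE t : x t i 0 = x0 i 0 + L t i 0 - (Z t i 0 - \sum_s P s i * Z t s 0).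
    by rewrite /x mxE [X in X + _]mxE [X in _ + X]mxE flow_coord.
  rewrite mxE [X in _ + X]mxE !xE.
  have /andP[L1 L2] := L_incr u v i u0 uv.
  have /andP[Z1 Z2] := Z_incr b u v i u0 uv vb.
  have : 0 <= \sum_s P s i * (Z v s 0 - Z u s 0) <= n%:R * (Q b * (v - u)).
    rewrite sumr_ge0/= => [|s _]; last first.
      by have /andP[Z1' _] := Z_incr b u v s u0 uv vb; rewrite mulr_ge0.
    apply: sum_ord_le => s; have /andP[Z1' Z2'] := Z_incr b u v s u0 uv vb.
    by apply: le_trans Z2'; rewrite -[leRHS]mul1r ler_wpM2r// routing_le1.
  rewrite (eq_bigr (fun s => P s i * Z v s 0 - P s i * Z u s 0)); last first.
    by move=> s _; ring.
  rewrite sumrB ler_norml => /andP[B1 B2].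
  have : 0 <= Q b * (v - u) by rewrite mulr_ge0// subr_ge0.
  have : 0 <= M * (v - u) by rewrite mulr_ge0// subr_ge0.
  by move=> *; apply/andP; split; lra.
- move=> i mJ Y mY.
  have -> : (fun t => z t i 0) = upper_quotient_limit (fun s => Z s i 0).
    by apply/funext => t; rewrite /z mxE.
  apply: borel_lebesgue_measurable; apply: measurableI; first exact: measurable_itv.
  have := @measurable_upper_quotient_limit R (fun s => Z s i 0) Q (Z_incrR i).
  by move=> /(_ measurableT Y mY); rewrite setTI.
- by move=> t; rewrite in_itv/= andbT => /x_ge0.
have Zder : {ae @lebesgue_measure R, forall t : R, forall i, 0 < t ->
    derivable (fun s => Z s i 0) t 1}.
  apply: filter_forall => i; apply: (@ae_derivable_local R _ Q) => T u v.
  exact: Z_incr.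
apply: filterS3 (ae_neq0 R) Lder Zder => t tneq0 Lt Zt tJ.
have t_ge0 : 0 <= t by move: tJ; rewrite in_itv/= andbT.
have t0 : 0 < t by rewrite lt_neqAle eq_sym tneq0.
have zt i : is_derive t 1 (fun s => Z s i 0) (z t i 0).
  have Zi : is_derive t 1 (fun s => Z s i 0) ('D_1 (fun s => Z s i 0) t).
    by split => //; exact: Zt.
  by rewrite mxE (is_derive_upper_quotient_limit Zi).
have z_le i : z t i 0 <= zeta (x t) i 0.
  apply/ler_addgt0Pr => e e0.
  have [|d d0 Zd] := upper t i (zeta (x t) i 0 + e) t_ge0 _; first by rewrite ltrDl.
  apply: (is_derive_right_le (zt i) d0) => v tv vd.
  by apply: Zd => //; rewrite lexx.
split.
- apply: is_derive_col => i.
  have dsum : is_derive t 1 (\sum_j (P j i *: (fun s => Z s j 0)))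
      (\sum_j P j i *: z t j 0).
    by apply: is_derive_sum => j; apply: is_deriveZ.
  have := is_deriveB (is_deriveD (is_derive_cst (x0 i 0) t 1) (Lt t_ge0 i))
    (is_deriveB (zt i) dsum).
  congr (is_derive t 1 _ _).
    apply/funext => s; rewrite /x [RHS]mxE [X in _ = X + _]mxE [X in _ = _ + X]mxE.
    by rewrite flow_coord !fctE fct_sumE.
  by rewrite add0r [RHS]mxE [X in _ = _ + X]mxE flow_coord.
- move=> i; rewrite mxE.
  have := is_derive_right_le (is_deriveN (zt i)) ltr01 (q := 0) _.
  rewrite oppr_le0; apply => v tv _.
  have /andP[Z1 _] := Z_incr v t v i t_ge0 tv (lexx v).
  by rewrite mul0r/= opprK addrC subr_le0 -subr_ge0.
- exact: z_le.
(* Every term of the complementarity sum vanishes: either the cell is empty, or [lower], through the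
   derivative of the negated [Z], gives the reverse of [z_le]. *)
apply/matrixP => i j; rewrite !ord1 [RHS]mxE mxE big1// => k _.
rewrite mxE [X in _ * X]mxE [X in _ * (_ + X)]mxE.
have [xk|xk] := ltP 0 (x t k 0); last first.
  have -> : x t k 0 = 0; last by rewrite mul0r.
  by apply/le_anti; rewrite xk; exact/orthant_coord/x_ge0.
suff -> : z t k 0 = zeta (x t) k 0 by rewrite subrr mulr0.
apply/le_anti; rewrite z_le/=; apply/ler_addgt0Pr => e e0.
have [|d d0 Zd] := lower t k (zeta (x t) k 0 - e) t_ge0 xk _.
  by rewrite ltrBlDr ltrDl.
rewrite -lerBlDr -lerN2.
apply: (is_derive_right_le (is_deriveN (zt k)) d0) => v tv vd.
have := Zd t v t_ge0 _ vd; rewrite lexx tv => /(_ isT).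
by rewrite /= !fctE; lra.
Qed.

End existence.

Theorem theorem3p1 (R : realType) (G : multigraph) (P : 'M[R]_#|link G|)
    (lambda : R -> 'cV[R]_#|link G|)
    (zeta : 'cV[R]_#|link G| -> 'cV[R]_#|link G|)
    (P_routing : routing_matrix P)
    (P_out_connected : out_connected P)
    (lambda_ge0 : forall t : R, 0 <= t -> orthant R #|link G| (lambda t))
    (lambda_bounded : [bounded lambda t | t in `[0, +oo[%classic])
    (lambda_measurable : lebesgue_measurable `[0, +oo[%classic lambda)
    (zeta_ge0 : forall x, orthant R #|link G| x -> orthant R #|link G| (zeta x))
    (zeta_lipschitz : [lipschitz zeta x | x in orthant R #|link G|])
    (x0 : 'cV[R]_#|link G|)
    (x0_ge0 : orthant R #|link G| x0) :
  exists x z : R -> 'cV[R]_#|link G|,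
    is_solution P lambda zeta `[0, +oo[ x0 x z /\
    forall x' z' : R -> 'cV[R]_#|link G|,
      is_solution P lambda zeta `[0, +oo[ x0 x' z' ->
      same_solution `[0, +oo[ x z x' z'.
Proof.
have [P_ge0 _ P_le1] := P_routing.
have [x [z xz]] := solution_exists P_ge0 P_le1 lambda_ge0 lambda_bounded
  lambda_measurable zeta_ge0 zeta_lipschitz x0_ge0.
exists x, z; split=> // x' z'; exact: solution_unique.
Qed.
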